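(* Let $n \geq 3$. Then for any convex body $K \subset \mathbb{R}^n$ the following are equivalent. (1) $K$ satisfies the translative constant volume property. (2) For some $\lambda > 0$, $\Pi^\circ K = \lambda (K-K)$ holds.
   Context: A convex body is a compact convex set with nonempty interior. $K-K = \{x-y : x,y \in K\}$ is the difference body of $K$. Two convex bodies touch each other if they intersect and their interiors are disjoint. A convex body $K \subset \mathbb{R}^n$ satisfies the translative constant volume property if $\operatorname{vol}_n(\operatorname{conv}((v+K) \cup (w+K)))$ has the same value for every pair $v,w \in \mathbb{R}^n$ such that $v+K$ and $w+K$ touch each other. For a unit vector $u \in \mathbb{S}^{n-1}$, $K|u^\perp$ is the orthogonal projection of $K$ onto the hyperplane through the origin with normal vector $u$. The projection body $\Pi K$ of $K$ is the convex body whose support function satisfies $h_{\Pi K}(u) = \operatorname{vol}_{n-1}(K|u^\perp)$ for all $u \in \mathbb{S}^{n-1}$. The polar projection body is $\Pi^\circ K = (\Pi K)^\circ$, where $M^\circ = \{y : \langle x,y\rangle \le 1 \text{ for all } x \in M\}$. *)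

(* Defs.v *)
(* MathComp-Analysis; R^n is the type 'rV[R]_n of row vectors over R : realType. *)
From mathcomp Require Import all_boot all_order all_algebra.
From mathcomp Require Import all_classical all_reals all_analysis.

Set Implicit Arguments.
Unset Strict Implicit.
Unset Printing Implicit Defensive.

Import Order.TTheory GRing.Theory Num.Theory.
Import numFieldNormedType.Exports.

Local Open Scope classical_set_scope.
Local Open Scope ring_scope.

(* The Euclidean inner product; the norm that the library puts on row vectors
   is the sup norm, so unit vectors are expressed through [dot]. *)
Definition dot (R : realType) (n : nat) (x y : 'rV[R]_n) : R :=
  \sum_(i < n) x ord0 i * y ord0 i.

Definition unit_vector (R : realType) (n : nat) (u : 'rV[R]_n) : Prop :=
  dot u u = 1.

(* Topological notions are those of the product topology on 'rV[R]_n, which is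
   the Euclidean topology. *)
Definition convex_body (R : realType) (n : nat) (K : set 'rV[R]_n) : Prop :=
  [/\ compact K, convex_set K & interior K !=set0].

Definition conv_hull (R : realType) (n : nat) (A : set 'rV[R]_n) :
    set 'rV[R]_n :=
  smallest (@convex_set R 'rV[R]_n) A.

Definition translate (R : realType) (n : nat) (v : 'rV[R]_n)
    (K : set 'rV[R]_n) : set 'rV[R]_n :=
  [set v + x | x in K].

Definition dilate (R : realType) (n : nat) (lambda : R) (K : set 'rV[R]_n) :
    set 'rV[R]_n :=
  [set lambda *: x | x in K].

Definition difference_body (R : realType) (n : nat) (K : set 'rV[R]_n) :
    set 'rV[R]_n :=
  [set x - y | x in K & y in K].

Definition touch (R : realType) (n : nat) (K L : set 'rV[R]_n) : Prop :=
  K `&` L !=set0 /\ interior K `&` interior L = set0.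

(* n-dimensional Lebesgue measure as the n-fold product of the Lebesgue measure
   of the line (the point mass when n = 0), carried by n-tuples. *)
Fixpoint lebesgue_tuple (R : realType) (n : nat) :
    set (n.-tuple (measurableTypeR R)) -> \bar R :=
  match n with
  | 0 => dirac [tuple]
  | n'.+1 => pushforward (@lebesgue_measure R \x @lebesgue_tuple R n')%E
               (fun p => [tuple of p.1 :: p.2])
  end.

Definition vol (R : realType) (n : nat) (A : set 'rV[R]_n) : \bar R :=
  @lebesgue_tuple R n [set t | A (\row_i tnth t i)].

Definition orthogonal_projection (R : realType) (n : nat) (u x : 'rV[R]_n) :
    'rV[R]_n :=
  x - dot x u *: u.

(* The rows of B form an orthonormal basis of the hyperplane u^perp. *)
Definition orthonormal_frame (R : realType) (n : nat) (u : 'rV[R]_n)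
    (B : 'M[R]_(n.-1, n)) : Prop :=
  B *m B^T = 1%:M /\ B *m u^T = 0.

(* (n-1)-dimensional volume of a subset A of u^perp: the isometry
   y |-> y *m B identifies R^(n-1) with u^perp. *)
Definition hyperplane_vol (R : realType) (n : nat) (u : 'rV[R]_n)
    (A : set 'rV[R]_n) : \bar R :=
  let B := get [set B : 'M[R]_(n.-1, n) | orthonormal_frame u B] in
  vol [set y : 'rV[R]_(n.-1) | A (y *m B)].

Definition support_function (R : realType) (n : nat) (K : set 'rV[R]_n)
    (u : 'rV[R]_n) : R :=
  sup [set dot x u | x in K].

Definition is_projection_body (R : realType) (n : nat)
    (K P : set 'rV[R]_n) : Prop :=
  convex_body P /\
  forall u : 'rV[R]_n, unit_vector u ->
    (support_function P u)%:E =
      hyperplane_vol u [set orthogonal_projection u x | x in K].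

(* "The" convex body with the prescribed support function: a convex body is
   determined by its support function on unit vectors. *)
Definition projection_body (R : realType) (n : nat) (K : set 'rV[R]_n) :
    set 'rV[R]_n :=
  get [set P : set 'rV[R]_n | is_projection_body K P].

Definition polar (R : realType) (n : nat) (M : set 'rV[R]_n) : set 'rV[R]_n :=
  [set y | forall x, M x -> dot x y <= 1].

Definition translative_constant_volume (R : realType) (n : nat)
    (K : set 'rV[R]_n) : Prop :=
  forall v w v' w' : 'rV[R]_n,
    touch (translate v K) (translate w K) ->
    touch (translate v' K) (translate w' K) ->
    vol (conv_hull (translate v K `|` translate w K)) =
    vol (conv_hull (translate v' K `|` translate w' K)).

(* Main.v *)
From HB Require Import structures.
Require Import Defs.
From mathcomp Require Import all_boot all_order all_algebra.
From mathcomp Require Import all_classical all_reals all_analysis.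
From mathcomp Require Import measurable_realfun ring lra.
Import Order.TTheory GRing.Theory Num.Theory.
Import numFieldNormedType.Exports.

(** For a convex body K, the convex hull of v + K and w + K is a translate of the
    Minkowski sum of K with the segment [0, x], where x = w - v
    ([conv_hull_translates]). Cutting that sum into lines parallel to x shows
    that its volume exceeds the one of K by h(x) = |x| vol(K | x^perp)
    ([vol_extrude_frame]): each line that meets K meets it in an interval, which
    the sum prolongs by |x|. This increase h is called the brightness here; on
    unit vectors it is the prescribed support function of the projection body,
    and it is homogeneous, so that the polar projection body is the sublevel set
    of the points y with h(y) <= 1 ([polar_projection_body]).

    The translates K and x + K touch exactly when x is the last point of the
    difference body K - K on its ray ([touchE], [contact_expand],
    [contact_on_ray]). The volume is therefore constant over touching pairs if
    and only if h is constant on the boundary of K - K, which by homogeneity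
    means that the sublevel set of h is a dilate of K - K
    ([constant_volume_polar_projection]).

    Two ingredients need work. The projection volume is measured in an arbitrary
    orthonormal frame, which calls for the invariance of the iterated Lebesgue
    measure under orthogonal matrices; it follows from the general rule
    [vol_mulmx], proved by a block elimination in which every factor acts on one
    coordinate or on the remaining ones. And the projection body must exist:
    h has to be the support function of a convex body. Its subadditivity
    ([brightnessD]) comes from extruding K along t u and then along t v for
    small t, where the error is controlled because the thickened body lies in a
    slightly enlarged copy of K; a finite-dimensional Hahn-Banach argument
    ([hahn_banach_row]) then provides the supporting points. *)

Set Implicit Arguments.
Unset Strict Implicit.
Unset Printing Implicit Defensive.

Local Open Scope classical_set_scope.
Local Open Scope ring_scope.

(** * The product measure on tuples *)

Section sigma_finite_constructions.
Context d1 d2 (T1 : measurableType d1) (T2 : measurableType d2) (R : realType).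

(** The rectangles built from two exhaustions by sets of finite measure,
    enumerated through a pairing of the naturals, exhaust the product. *)
Lemma sigma_finite_product (m1 : {sigma_finite_measure set T1 -> \bar R})
    (m2 : {sigma_finite_measure set T2 -> \bar R}) :
  exists m : {sigma_finite_measure set (T1 * T2)%type -> \bar R},
    (m1 \x m2)%E = m.
Proof.
pose pm :=
  lebesgue_integral_fubini_product_measure1__canonical__measure_function_Measure
    m1 m2.
have sf : sigma_finite setT (m1 \x m2)%E.
  have [F UF Ff] := sigma_finiteT m1.
  have [G UG Gf] := sigma_finiteT m2.
  pose e k : nat * nat := odflt (0, 0)%N (unpickle k).
  exists (fun k => F (e k).1 `*` G (e k).2).
    apply/esym/seteqP; split => // -[x y] _.
    have [i _ Fi] : (\bigcup_i F i) x by rewrite -UF.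
    have [j _ Gj] : (\bigcup_i G i) y by rewrite -UG.
    by exists (pickle (i, j)) => //; rewrite /e pickleK.
  move=> k; have [mF fF] := Ff (e k).1; have [mG fG] := Gf (e k).2.
  split; first exact: measurableX.
  by rewrite product_measure1E// lte_mul_pinfty// ge0_fin_numE.
pose mx := Measure_isSigmaFinite.Build _ _ _ (m1 \x m2)%E sf.
pose sm : {sigma_finite_measure set (T1 * T2)%type -> \bar R} :=
  HB.pack ((m1 \x m2)%E : set (T1 * T2) -> \bar R) (Measure.class pm) mx.
by exists sm.
Qed.

(** A measurable left inverse carries an exhaustion of the source to one of the
    target. *)
Lemma sigma_finite_pushforward (m : {sigma_finite_measure set T1 -> \bar R})
    (f : T1 -> T2) (g : T2 -> T1) :
  measurable_fun setT f -> measurable_fun setT g -> cancel f g ->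
  exists m' : {sigma_finite_measure set T2 -> \bar R}, pushforward m f = m'.
Proof.
move=> mf mg fK.
pose pm :=
  measure_function_pushforward__canonical__measure_function_Measure m mf.
have sf : sigma_finite setT (pushforward m f).
  have [F UF Ff] := sigma_finiteT m.
  exists (fun k => g @^-1` F k).
    by rewrite -preimage_bigcup -UF preimage_setT.
  move=> k; have [mFk fk] := Ff k; split.
    by rewrite -[X in measurable X]setTI; exact: mg.
  rewrite /pushforward -comp_preimage (_ : g \o f = idfun) ?preimage_id//.
  by apply/funext => x; exact: fK.
pose mx := Measure_isSigmaFinite.Build _ _ _ pm sf.
pose sm : {sigma_finite_measure set T2 -> \bar R} :=
  HB.pack (pushforward m f : set T2 -> \bar R) (Measure.class pm) mx.
by exists sm.
Qed.

End sigma_finite_constructions.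

Section lebesgue_tuple_measure.
Variable R : realType.
Local Notation rT := (measurableTypeR R).

(** The recursive definition uses the bare set function of the lower dimension,
    so that the measure structure is obtained by induction, all at once. *)
Lemma lebesgue_tuple_measure n :
  exists m : {sigma_finite_measure set (n.-tuple rT) -> \bar R},
    @lebesgue_tuple R n = m.
Proof.
elim: n => [|n [m IH]] /=.
  by exists (@dirac _ (0.-tuple rT) [tuple] R :
    {sigma_finite_measure set _ -> \bar R}).
have [pm ->] : exists pm :
    {sigma_finite_measure set (rT * n.-tuple rT)%type -> \bar R},
    (@lebesgue_measure R \x @lebesgue_tuple R n)%E = pm.
  by rewrite IH; exact: sigma_finite_product.
pose g (t : n.+1.-tuple rT) : rT * n.-tuple rT := (thead t, [tuple of behead t]).
apply: (@sigma_finite_pushforward _ _ _ _ _ _ _ g).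
- exact: measurable_cons.
- apply: measurable_fun_pair; last exact: measurable_behead.
  exact: (@measurable_tnth _ rT n.+1 ord0).
- by move=> [a b]; rewrite /g/= theadE; congr pair; exact: val_inj.
Qed.

Let leb0 n : @lebesgue_tuple R n set0 = 0%E.
Proof. by have [m ->] := lebesgue_tuple_measure n; exact: measure0. Qed.
Let leb_ge0 n (A : set (n.-tuple rT)) : (0 <= lebesgue_tuple A)%E.
Proof. by have [m ->] := lebesgue_tuple_measure n; exact: measure_ge0. Qed.
Let leb_sigma n : semi_sigma_additive (@lebesgue_tuple R n).
Proof.
by have [m ->] := lebesgue_tuple_measure n; exact: measure_semi_sigma_additive.
Qed.
Let leb_sfin n : sigma_finite setT (@lebesgue_tuple R n).
Proof. by have [m ->] := lebesgue_tuple_measure n; exact: sigma_finiteT. Qed.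

HB.instance Definition _ n := isMeasure.Build _ _ _ (@lebesgue_tuple R n)
  (leb0 n) (@leb_ge0 n) (@leb_sigma n).
HB.instance Definition _ n := Measure_isSigmaFinite.Build _ _ _
  (@lebesgue_tuple R n) (@leb_sfin n).

End lebesgue_tuple_measure.

(** * Volume of sets of row vectors *)

Section first_coordinate.
Variable R : realType.

Definition vcons n (s : R) (y : 'rV[R]_n) : 'rV[R]_n.+1 :=
  row_mx (s%:M : 'M[R]_1) y.

Lemma vcons_head n (s : R) (y : 'rV[R]_n) : vcons s y ord0 ord0 = s.
Proof.
by rewrite /vcons mxE; case: splitP => // j _; rewrite (ord1 j) mxE eqxx.
Qed.

Lemma vcons_tail n (s : R) (y : 'rV[R]_n) i :
  vcons s y ord0 (lift ord0 i) = y ord0 i.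
Proof.
rewrite /vcons mxE; case: splitP => j /= ji; first by have := ltn_ord j; rewrite -ji.
by congr (y _ _); apply: val_inj; case: ji.
Qed.

Lemma vconsP n (x : 'rV[R]_n.+1) : exists s (y : 'rV[R]_n), x = vcons s y.
Proof.
exists (x ord0 ord0), (\row_i x ord0 (lift ord0 i)).
apply/rowP => i; rewrite /vcons mxE; case: splitP => j ij.
  rewrite (ord1 j) mxE eqxx; congr (x _ _); apply: val_inj.
  by rewrite /= ij (ord1 j).
by rewrite mxE; congr (x _ _); exact: val_inj.
Qed.

Lemma vconsD n (s s' : R) (y y' : 'rV[R]_n) :
  vcons s y + vcons s' y' = vcons (s + s') (y + y').
Proof. by rewrite /vcons (@add_row_mx R 1 1 n) raddfD. Qed.

Lemma vconsZ n (l s : R) (y : 'rV[R]_n) : l *: vcons s y = vcons (l * s) (l *: y).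
Proof. by rewrite /vcons (@scale_row_mx R 1 1 n) scale_scalar_mx. Qed.

Lemma vcons_inj n (s s' : R) (y y' : 'rV[R]_n) :
  vcons s y = vcons s' y' -> s = s' /\ y = y'.
Proof.
move=> E; split; first by rewrite -[s](vcons_head _ y) E vcons_head.
by apply/rowP => i; rewrite -(vcons_tail s) E vcons_tail.
Qed.

Lemma vcons_vec n (s : R) (y : 'rV[R]_n) : vcons s y = s *: vcons 1 0 + vcons 0 y.
Proof. by rewrite vconsZ vconsD mulr1 scaler0 add0r addr0. Qed.

Lemma vcons_mul n (s a : R) (y v : 'rV[R]_n) (w : 'cV[R]_n) (D : 'M[R]_n) :
  vcons s y *m (block_mx a%:M v w D : 'M[R]_(1 + n)) =
  vcons (s * a + (y *m w) ord0 ord0) (s *: v + y *m D).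
Proof.
rewrite /vcons (@mul_row_block R 1 1 n 1 n) !mul_scalar_mx scale_scalar_mx.
by rewrite raddfD/= -mx11_scalar.
Qed.

End first_coordinate.

Section volume.
Variable R : realType.
Local Notation rT := (measurableTypeR R).
Local Notation leb := (@lebesgue_measure R).

Definition row_of_tuple n (t : n.-tuple R) : 'rV[R]_n := \row_i tnth t i.

Definition tuple_of_row n (x : 'rV[R]_n) : n.-tuple R :=
  [tuple x ord0 i | i < n].

Lemma tuple_of_rowK n : cancel (@tuple_of_row n) (@row_of_tuple n).
Proof. by move=> x; apply/rowP => i; rewrite !mxE tnth_mktuple. Qed.

(** Measurability of a set of row vectors is that of the set of tuples whose
    Lebesgue measure [vol] takes. *)
Definition row_measurable n (A : set 'rV[R]_n) :=
  measurable ((@row_of_tuple n @^-1` A) : set (n.-tuple rT)).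

Lemma volE n (A : set 'rV[R]_n) :
  vol A = @lebesgue_tuple R n (@row_of_tuple n @^-1` A).
Proof. by []. Qed.

Lemma vol_ge0 n (A : set 'rV[R]_n) : (0 <= vol A)%E.
Proof. exact: measure_ge0. Qed.

Lemma le_vol n (A B : set 'rV[R]_n) : row_measurable A -> row_measurable B ->
  A `<=` B -> (vol A <= vol B)%E.
Proof.
move=> mA mB AB; rewrite !volE; apply: le_measure; rewrite ?inE// => t; exact: AB.
Qed.

(** The sigma-algebra on tuples is generated by the coordinates, so that these
    decide measurability. *)
Lemma row_measurable_preimage n m (f : 'rV[R]_n -> 'rV[R]_m) (A : set 'rV[R]_m) :
  (forall j, measurable_fun [set: n.-tuple rT]
     (fun t => f (row_of_tuple t) ord0 j : rT)) ->
  row_measurable A -> row_measurable (f @^-1` A).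
Proof.
move=> mf mA.
have mg : measurable_fun [set: n.-tuple rT]
    (fun t => tuple_of_row (f (row_of_tuple t)) : m.-tuple rT).
  apply/measurable_fun_tnthP => j.
  rewrite (_ : _ \o _ = fun t => f (row_of_tuple t) ord0 j)//.
  by apply/funext => t /=; rewrite tnth_mktuple.
have := mg measurableT _ mA; rewrite setTI.
by congr measurable; apply/seteqP; split => t /=; rewrite tuple_of_rowK.
Qed.

Lemma measurable_coord n (i : 'I_n) :
  measurable_fun [set: n.-tuple rT] (fun t => row_of_tuple t ord0 i : rT).
Proof.
rewrite (_ : (fun _ => _) = (fun t => tnth t i)); first exact: measurable_tnth.
by apply/funext => t; rewrite mxE.
Qed.

Lemma row_measurable_affine n m (M : 'M[R]_(n, m)) (b : 'rV[R]_m)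
    (A : set 'rV[R]_m) :
  row_measurable A -> row_measurable [set x | A (x *m M + b)].
Proof.
apply: row_measurable_preimage => j.
rewrite (_ : (fun _ => _) =
  (fun t : n.-tuple rT => \sum_i (row_of_tuple t ord0 i * M i j) + b ord0 j)).
  apply: measurable_funD; last exact: measurable_cst.
  apply: measurable_sum => i; apply: measurable_funM; last exact: measurable_cst.
  exact: measurable_coord.
by apply/funext => t; rewrite !mxE.
Qed.

Local Notation cut n :=
  (fun p : rT * n.-tuple rT => vcons p.1 (row_of_tuple p.2)).

Lemma row_of_tuple_cons n (s : R) (t : n.-tuple R) :
  row_of_tuple [tuple of s :: t] = vcons s (row_of_tuple t).
Proof.
apply/rowP => i; rewrite /vcons !mxE (tnth_nth 0); case: splitP => j ->.
  by rewrite (ord1 j) mxE eqxx.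
by rewrite mxE (tnth_nth 0).
Qed.

Lemma measurable_cut n (A : set 'rV[R]_n.+1) : row_measurable A ->
  measurable ((cut n) @^-1` A).
Proof.
move=> mA.
have mc : measurable_fun [set: rT * n.-tuple rT]
    (fun p => [tuple of p.1 :: p.2] : n.+1.-tuple rT).
  exact: measurable_cons.
have := mc measurableT _ mA; rewrite setTI.
by congr measurable; apply/seteqP; split => -[s t] /=; rewrite row_of_tuple_cons.
Qed.

(** The recursion of the measure integrates the volumes of the slices over the
    first coordinate; [vol_inner] is the other order, by Tonelli. *)
Lemma vol_outer n (A : set 'rV[R]_n.+1) :
  vol A = (\int[leb]_s vol [set y : 'rV[R]_n | A (vcons s y)])%E.
Proof.
rewrite volE /= /pushforward /product_measure1 /=.
apply: eq_integral => s _; rewrite volE; congr lebesgue_tuple.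
by apply/seteqP; split => t; rewrite /xsection/= inE/= row_of_tuple_cons.
Qed.

Lemma vol_inner n (A : set 'rV[R]_n.+1) : row_measurable A ->
  vol A = (\int[@lebesgue_tuple R n]_t
             leb [set s | A (vcons s (row_of_tuple t))])%E.
Proof.
move=> mA; have mA' := measurable_cut mA.
rewrite volE /= /pushforward.
rewrite (_ : (_ @^-1` _) = (cut n) @^-1` A); last first.
  by apply/seteqP; split => -[s t] /=; rewrite row_of_tuple_cons.
have := indic_fubini_tonelli leb (@lebesgue_tuple R n) mA'.
rewrite indic_fubini_tonelli_FE// indic_fubini_tonelli_GE//= => E.
apply: etrans E _; apply: eq_integral => t _ /=; congr lebesgue_measure.
by apply/seteqP; split => s; rewrite /ysection/= inE.
Qed.

Lemma row_measurable_slice n (A : set 'rV[R]_n.+1) (s : R) : row_measurable A ->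
  row_measurable [set y : 'rV[R]_n | A (vcons s y)].
Proof.
move=> /measurable_cut /(measurable_xsection s); congr measurable.
by apply/seteqP; split => t; rewrite /xsection/= inE.
Qed.

Lemma measurable_line n (A : set 'rV[R]_n.+1) (y : 'rV[R]_n) : row_measurable A ->
  measurable ([set s | A (vcons s y)] : set rT).
Proof.
move=> /measurable_cut /(measurable_ysection (tuple_of_row y)); congr measurable.
by apply/seteqP; split => t; rewrite /ysection/= inE/= tuple_of_rowK.
Qed.

End volume.

(** * Affine change of variables *)

Section affine_change_of_variables.
Variable R : realType.
Local Notation rT := (measurableTypeR R).
Local Notation leb := (@lebesgue_measure R).

Lemma measurable_affine (a b : R) :
  measurable_fun [set: rT] (fun s : rT => a * s + b : rT).
Proof.
apply: measurable_funD; last exact: measurable_cst.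
by apply: measurable_funM; [exact: measurable_cst|exact: measurable_id].
Qed.

(** Both sides are measures in B, so it suffices to compare them on half-open
    intervals. *)
Lemma lebesgue_measure_affine (a b : R) (B : set rT) : a != 0 -> measurable B ->
  leb B = (`|a|%:E * leb [set s : rT | B (a * s + b)%R])%E.
Proof.
move=> a0 mB.
have mf := measurable_affine a b.
pose pm :=
  measure_function_pushforward__canonical__measure_function_Measure leb mf.
pose m : {measure set rT -> \bar R} := mscale (NngNum (normr_ge0 a)) pm.
apply: (@lebesgue_measure_unique R m) => // _ [[x y]] _ <-.
rewrite /m /mscale /= /pushforward lebesgue_measure_itv/= lte_fin.
move: a0; rewrite neq_lt => /orP[a0|a0].
- transitivity (`|a|%:E * leb (`[(y - b) / a, (x - b) / a[%classic)%R)%E; last first.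
    congr (_ * leb _)%E.
    apply/seteqP; split => s /=; rewrite !in_itv/= ler_ndivrMr// ltr_ndivlMr//;
    by move=> /andP[? ?]; apply/andP; split; lra.
  rewrite lebesgue_measure_itv/= lte_fin ltr_nM2r ?invr_lt0// ltrD2r.
  case: ifP => _; rewrite ?mule0// -EFinB -EFinM ltr0_norm//; congr EFin.
  by field; lra.
- transitivity (`|a|%:E * leb (`](x - b) / a, (y - b) / a]%classic)%R)%E; last first.
    congr (_ * leb _)%E.
    apply/seteqP; split => s /=; rewrite !in_itv/= ler_pdivlMr// ltr_pdivrMr//;
    by move=> /andP[? ?]; apply/andP; split; lra.
  rewrite lebesgue_measure_itv/= lte_fin ltr_pM2r ?invr_gt0// ltrD2r.
  case: ifP => _; rewrite ?mule0// -EFinB -EFinM gtr0_norm//; congr EFin.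
  by field; lra.
Qed.

(** A map that keeps the last coordinates and acts on each line parallel to the
    first axis by an affine map of slope a, independent of the line. *)
Lemma vol_line_scaling n (f : 'rV[R]_n.+1 -> 'rV[R]_n.+1) (a : R)
    (b : 'rV[R]_n -> R) (A : set 'rV[R]_n.+1) :
  (forall s y, f (vcons s y) = vcons (a * s + b y) y) -> a != 0 ->
  row_measurable A -> row_measurable (f @^-1` A) ->
  vol A = (`|a|%:E * vol (f @^-1` A))%E.
Proof.
move=> fE a0 mA mfA; rewrite !vol_inner// -ge0_integralZl//=.
- apply: eq_integral => t _.
  rewrite (lebesgue_measure_affine (b (row_of_tuple t)) a0); last first.
    exact: measurable_line.
  by congr (_ * leb _)%E; apply/seteqP; split => s /=; rewrite fE.
- have /(measurable_fun_ysection leb) := measurable_cut mfA.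
  congr measurable_fun; apply/funext => t /=; congr lebesgue_measure.
  by apply/seteqP; split => s; rewrite /ysection/= inE.
Qed.

(** The counterpart for a map that keeps the first coordinate and multiplies
    volume by the same factor in each slice. *)
Lemma vol_slice_scaling n (f : 'rV[R]_n.+1 -> 'rV[R]_n.+1)
    (g : R -> 'rV[R]_n -> 'rV[R]_n) (c : R) (A : set 'rV[R]_n.+1) :
  (forall s y, f (vcons s y) = vcons s (g s y)) -> 0 <= c ->
  (forall s (B : set 'rV[R]_n), row_measurable B ->
    vol B = (c%:E * vol (g s @^-1` B))%E) ->
  row_measurable A -> row_measurable (f @^-1` A) ->
  vol A = (c%:E * vol (f @^-1` A))%E.
Proof.
move=> fE c0 gE mA mfA; rewrite !vol_outer// -ge0_integralZl//=.
- apply: eq_integral => s _.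
  rewrite (gE s); last exact: row_measurable_slice.
  by congr (_ * vol _)%E; apply/seteqP; split => y /=; rewrite fE.
- have /(measurable_fun_xsection (@lebesgue_tuple R n)) := measurable_cut mfA.
  congr measurable_fun; apply/funext => t /=; rewrite volE; congr lebesgue_tuple.
  by apply/seteqP; split => s; rewrite /xsection/= inE.
Qed.

Lemma row_measurable_translation n (b : 'rV[R]_n) (A : set 'rV[R]_n) :
  row_measurable A -> row_measurable [set x | A (x + b)].
Proof.
move=> mA; rewrite (_ : mkset _ = [set x | A (x *m 1%:M + b)]).
  exact: row_measurable_affine.
by apply/seteqP; split => x /=; rewrite mulmx1.
Qed.

Lemma row_measurable_mulmx n m (M : 'M[R]_(n, m)) (A : set 'rV[R]_m) :
  row_measurable A -> row_measurable [set x | A (x *m M)].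
Proof.
move=> mA; rewrite (_ : mkset _ = [set x | A (x *m M + 0)]).
  exact: row_measurable_affine.
by apply/seteqP; split => x /=; rewrite addr0.
Qed.

Lemma vol_translation n (b : 'rV[R]_n) (A : set 'rV[R]_n) : row_measurable A ->
  vol [set x | A (x + b)] = vol A.
Proof.
elim: n b A => [|n IH] b A mA.
  congr vol; apply/seteqP; split => x /=;
  by rewrite (thinmx0 (x + b)) (thinmx0 x).
have [b0 [b' ->]] := vconsP b.
have -> : [set x | A (x + vcons b0 b')] =
   (fun x => x + vcons 0 b') @^-1` ((fun x => x + vcons b0 0) @^-1` A).
  by apply/seteqP; split => x /=; rewrite -addrA vconsD add0r addr0.
have mA1 := row_measurable_translation (vcons b0 0) mA.
symmetry; rewrite (@vol_line_scaling n (fun x => x + vcons b0 0) 1 (fun=> b0));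
  rewrite ?oner_neq0//.
- rewrite normr1 mul1e (@vol_slice_scaling n (fun x => x + vcons 0 b')
    (fun _ y => y + b') 1) ?mul1e//.
  + by move=> s y; rewrite vconsD addr0.
  + by move=> s B mB; rewrite mul1e; apply/esym; exact: IH.
  + exact: row_measurable_translation.
- by move=> s y; rewrite vconsD addr0 mul1r.
Qed.

Definition scales_volume n (M : 'M[R]_n) := forall A : set 'rV[R]_n,
  row_measurable A -> vol A = (`|\det M|%:E * vol [set x | A (x *m M)])%E.

Lemma scales_volumeM n (M N : 'M[R]_n) :
  scales_volume M -> scales_volume N -> scales_volume (M *m N).
Proof.
move=> PM PN A mA; rewrite (PN _ mA) (PM _ (row_measurable_mulmx N mA)).
rewrite muleA -EFinM det_mulmx normrM [in RHS]mulrC; congr (_ * vol _)%E.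
by apply/seteqP; split => x /=; rewrite mulmxA.
Qed.

Lemma scales_volume_lower n (w : 'cV[R]_n) :
  scales_volume (block_mx 1%:M 0 w 1%:M : 'M[R]_(1 + n)).
Proof.
move=> A mA; rewrite det_lblock !det1 mulr1.
apply: (@vol_line_scaling n
  (fun x => x *m (block_mx 1%:M 0 w 1%:M : 'M[R]_(1 + n))) 1
  (fun y => (y *m w) ord0 ord0)) => //; last exact: row_measurable_mulmx.
by move=> s y; rewrite vcons_mul mulr1 mul1r scaler0 add0r mulmx1.
Qed.

Lemma scales_volume_upper n (v : 'rV[R]_n) :
  scales_volume (block_mx 1%:M v 0 1%:M : 'M[R]_(1 + n)).
Proof.
move=> A mA; rewrite det_ublock !det1 mulr1 normr1.
apply: (@vol_slice_scaling n
  (fun x => x *m (block_mx 1%:M v 0 1%:M : 'M[R]_(1 + n)))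
  (fun s y => y + s *: v)) => //; last exact: row_measurable_mulmx.
- by move=> s y; rewrite vcons_mul mulr1 mulmx0 mxE addr0 mulmx1 addrC.
- by move=> s B mB; rewrite mul1e; apply/esym; exact: vol_translation.
Qed.

Lemma scales_volume_corner n (a : R) : a != 0 ->
  scales_volume (block_mx a%:M 0 0 1%:M : 'M[R]_(1 + n)).
Proof.
move=> a0 A mA; rewrite det_ublock det_scalar1 det1 mulr1.
apply: (@vol_line_scaling n
  (fun x => x *m (block_mx a%:M 0 0 1%:M : 'M[R]_(1 + n))) a (fun y => 0)) => //;
  last exact: row_measurable_mulmx.
by move=> s y; rewrite vcons_mul mulmx0 mxE scaler0 add0r mulmx1 mulrC.
Qed.

Lemma scales_volume_block n (D : 'M[R]_n) : scales_volume D ->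
  scales_volume (block_mx 1%:M 0 0 D : 'M[R]_(1 + n)).
Proof.
move=> PD A mA; rewrite det_ublock det1 mul1r.
apply: (@vol_slice_scaling n
  (fun x => x *m (block_mx 1%:M 0 0 D : 'M[R]_(1 + n)))
  (fun s y => y *m D)) => //; last exact: row_measurable_mulmx.
by move=> s y; rewrite vcons_mul mulmx0 mxE scaler0 add0r mulr1 addr0.
Qed.

Lemma corner_block n (a : 'M[R]_1) (v : 'rV[R]_n) (w : 'cV[R]_n) (D : 'M[R]_n) :
  (block_mx a v w D : 'M[R]_(1 + n)) ord0 ord0 = a ord0 ord0.
Proof.
rewrite -(block_mxEul a v w D ord0 ord0).
by congr (block_mx _ _ _ _ _ _); exact: val_inj.
Qed.

(** A matrix with nonzero corner factors as lower shear, block diagonal, upper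
    shear; the shears act by translations on the fibres of one of the two
    projections, and the block diagonal matrix is a scaling of the first
    coordinate combined with the Schur complement, which has one dimension
    less. *)
Lemma vol_mulmx n (M : 'M[R]_n) (A : set 'rV[R]_n) : M \in unitmx ->
  row_measurable A -> vol A = (`|\det M|%:E * vol [set x | A (x *m M)])%E.
Proof.
move=> Mu; move: A; rewrite -/(scales_volume M).
elim: n M Mu => [|n IH] M Mu.
  move=> A mA; rewrite det_mx00 normr1 mul1e.
  congr vol; apply/seteqP; split => x /=;
  by rewrite (thinmx0 (x *m M)) (thinmx0 x).
rewrite -[n.+1]/(1 + n)%N in M Mu *.
wlog : M Mu / M ord0 ord0 != 0 => [WL|].
  (* a vanishing corner is filled by adding a suitable row to the first one *)
  have [M0|/WL] := eqVneq (M ord0 ord0) 0; last exact.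
  have [i Mi] : exists i : 'I_n, M (rshift 1 i) ord0 != 0.
    apply: contrapT => /forallNP Mi; move: Mu.
    rewrite unitmxE (expand_det_col _ ord0).
    rewrite big1 ?unitr0// => j _; case: (@split_ordP 1 n j) => k ->.
      rewrite (ord1 k) (_ : lshift n ord0 = ord0) ?M0 ?mul0r//.
      exact: val_inj.
    by have /negP := Mi k; rewrite negbK => /eqP ->; rewrite mul0r.
  pose S e : 'M[R]_(1 + n) := block_mx 1%:M (e *: delta_mx ord0 i) 0 1%:M.
  have SS : S (-1) *m S 1 = 1%:M.
    rewrite /S mulmx_block !mul1mx !mulmx1 !mulmx0 !mul0mx !addr0 !add0r.
    by rewrite scaleN1r scale1r subrr -scalar_mx_block.
  have -> : M = S (-1) *m (S 1 *m M) by rewrite mulmxA SS mul1mx.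
  apply: scales_volumeM; first exact: scales_volume_upper.
  apply: WL.
    have /mulmx1_unit[_ Su] := SS.
    by rewrite unitmx_mul Su.
  rewrite -[M]submxK /S mulmx_block scale1r !mul1mx.
  rewrite corner_block mxE -rowE !mxE.
  rewrite (_ : lshift n ord0 = ord0) ?M0 ?add0r//; last exact: val_inj.
move=> a0.
have E := submxK M.
set c := dlsubmx M in E; set r := ursubmx M in E; set D := drsubmx M in E.
pose a := M ord0 ord0.
have aE : ulsubmx M = a%:M.
  rewrite [LHS]mx11_scalar; congr (_%:M); rewrite !mxE.
  by congr (M _ _); exact: val_inj.
pose D' := D - a^-1 *: (c *m r).
have F : M = (block_mx 1%:M 0 (a^-1 *: c) 1%:M : 'M[R]_(1 + n)) *m
   ((block_mx a%:M 0 0 1%:M : 'M[R]_(1 + n)) *m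
    ((block_mx 1%:M 0 0 D' : 'M[R]_(1 + n)) *m
     (block_mx 1%:M (a^-1 *: r) 0 1%:M : 'M[R]_(1 + n)))).
  rewrite -[LHS]E aE.
  rewrite !(mulmx_block, mul1mx, mulmx1, mul0mx, mulmx0, addr0, add0r).
  rewrite mul_scalar_mx mul_mx_scalar !scalerA divff// !scale1r.
  by rewrite /D' -scalemxAl addrCA subrr addr0.
rewrite F.
apply: scales_volumeM; first exact: scales_volume_lower.
apply: scales_volumeM; first exact: scales_volume_corner.
apply: scales_volumeM; last exact: scales_volume_upper.
apply: scales_volume_block; apply: IH.
move: Mu; rewrite F !unitmxE !det_mulmx => Mu.
have : \det (block_mx 1%:M 0 0 D' : 'M[R]_(1 + n)) \is a GRing.unit.
  by move: Mu; rewrite !unitrM => /and4P[].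
by rewrite det_ublock det1 mul1r.
Qed.

Lemma vol_orthogonal n (Q : 'M[R]_n) (A : set 'rV[R]_n) : Q *m Q^T = 1%:M ->
  row_measurable A -> vol [set x | A (x *m Q)] = vol A.
Proof.
move=> QQ mA; have [Qu _] := mulmx1_unit QQ.
have /(congr1 determinant) := QQ; rewrite det_mulmx det_tr det1 -expr2 => dQ2.
have : `|\det Q| ^+ 2 == 1 by rewrite -normrX dQ2 normr1.
rewrite pexpr_eq1// => /eqP dQ.
by rewrite [RHS](vol_mulmx Qu mA) dQ mul1e.
Qed.

Lemma vol_dilation n (s : R) (A : set 'rV[R]_n) : 0 < s ->
  row_measurable A -> vol A = ((s ^+ n)%:E * vol [set x | A (s *: x)])%E.
Proof.
move=> s0 mA; have su : (s%:M : 'M[R]_n) \in unitmx.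
  by rewrite unitmxE det_scalar unitrX// unitfE gt_eqF.
rewrite (vol_mulmx su mA) det_scalar ger0_norm ?exprn_ge0 ?ltW//.
by congr (_ * vol _)%E; apply/seteqP; split => x /=; rewrite mul_mx_scalar.
Qed.

End affine_change_of_variables.

(** * Closed sets and cubes *)

Section borel_rows.
Variable R : realType.
Local Notation rT := (measurableTypeR R).

Lemma row_norm_le n (x : 'rV[R]_n) (r : R) : 0 <= r ->
  (`|x| <= r) <-> (forall i, `|x ord0 i| <= r).
Proof.
move=> r0; have -> : `|x| = mx_norm x by [].
rewrite mx_normrE; split.
  by move=> /bigmax_leP[_ xr] i; exact: (xr (ord0, i)).
move=> xr; apply/bigmax_leP; split => // -[j i] _ /=; rewrite (ord1 j); exact: xr.
Qed.

Lemma row_coord_le n (x : 'rV[R]_n) i : `|x ord0 i| <= `|x|.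
Proof. by have /row_norm_le := lexx `|x|; apply. Qed.

Definition cube n (r : R) : set 'rV[R]_n := [set x | `|x| <= r].
Arguments cube : clear implicits.

Lemma row_measurable_ball n (q : 'rV[R]_n) (e : R) : 0 < e ->
  row_measurable (ball q e).
Proof.
move=> e0; rewrite /row_measurable.
rewrite (_ : _ @^-1` _ = \bigcap_(i in [set: 'I_n])
   [set t : n.-tuple rT | `](q ord0 i - e), (q ord0 i + e)[%classic (tnth t i)]).
  apply: fin_bigcap_measurable => [|i _]; first exact: finite_finset.
  rewrite -[X in measurable X]setTI.
  exact: (@measurable_tnth _ rT n i).
apply/seteqP; split => t /=.
  case=> _ H i _; have := H ord0 i; rewrite mxE /= in_itv/= /ball/= ltr_distl.
  by move=> /andP[? ?]; apply/andP; split; lra.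
move=> H; split => // j i; have := H i I.
rewrite (ord1 j) mxE/= in_itv/= /ball/= ltr_distl.
by move=> /andP[? ?]; apply/andP; split; lra.
Qed.

(** A closed set is the intersection over k of the union of the rational boxes
    of radius 1/(k+1) that meet it. *)
Lemma row_measurable_closed n (A : set 'rV[R]_n) : closed A -> row_measurable A.
Proof.
move=> cA.
pose bx k (q : 'rV[rat]_n) : set 'rV[R]_n :=
  @ball R 'rV[R]_n (map_mx ratr q) (k.+1%:R^-1).
have -> : A = \bigcap_(k in [set: nat])
    \bigcup_(q in [set q | A `&` bx k q !=set0]) bx k q.
  apply/seteqP; split => [x Ax k _|x Hx].
    have k0 : 0 < k.+1%:R^-1 :> R by rewrite invr_gt0 ltr0n.
    have /choice[q Hq] : forall i : 'I_n, exists q : rat,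
        `|ratr q - x ord0 i| < k.+1%:R^-1.
      move=> i; have [|q /itvP Hq] :=
        @rat_in_itvoo R (x ord0 i - k.+1%:R^-1) (x ord0 i + k.+1%:R^-1).
        by rewrite ltrBlDr -addrA ltrDl addr_gt0.
      by exists q; rewrite ltr_distl !Hq.
    have bqx : bx k (\row_i q i) x.
      by split => // j i; rewrite (ord1 j) !mxE; exact: Hq.
    by exists (\row_i q i) => //=; exists x.
  apply: contrapT => nAx.
  have : nbhs x (~` A) by apply: open_nbhs_nbhs; split => //; exact: closed_openC.
  move=> /nbhs_ballP[e /= e0 xe].
  have [k ke] : exists k, k.+1%:R^-1 < e / 2.
    have [|k] := @ltr_add_invr R 0 (e / 2); first by rewrite divr_gt0.
    by rewrite add0r => ?; exists k.
  have [q [y [Ay qy]] qx] := Hx k I.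
  apply: (xe y) => //; apply: le_ball (ball_triangle (ball_sym qx) qy).
  by rewrite [leRHS]splitr; apply: lerD; exact: ltW.
rewrite /row_measurable preimage_bigcap; apply: bigcap_measurableType => k _.
rewrite preimage_bigcup bigcup_mkcond.
apply: countable_bigcupT_measurable => // q.
case: ifP => _; last exact: measurable0.
by apply: row_measurable_ball; rewrite invr_gt0 ltr0n.
Qed.

Lemma closed_cube n (r : R) : closed (cube n r).
Proof.
rewrite (_ : cube n r = (fun x => `|x|) @^-1` [set t | t <= r])//.
apply: (@closed_comp _ R^o); last exact: closed_le.
by move=> x _; exact: (@norm_continuous R 'rV[R]_n).
Qed.

Lemma vcons_norm_le n (s r : R) (y : 'rV[R]_n) : 0 <= r ->
  (`|vcons s y| <= r) <-> (`|s| <= r /\ `|y| <= r).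
Proof.
move=> r0; rewrite !row_norm_le//; split.
  move=> H; split.
    by have := H ord0; rewrite vcons_head.
  by move=> i; have := H (lift ord0 i); rewrite vcons_tail.
move=> [sr yr] i; rewrite /vcons mxE; case: splitP => j _ //.
by rewrite (ord1 j) mxE eqxx.
Qed.

Lemma vol_cube n (r : R) : 0 <= r -> vol (cube n r) = ((r *+ 2) ^+ n)%:E.
Proof.
move=> r0; elim: n => [|n IH].
  rewrite /vol/= /dirac/= indicE mem_set ?expr0//=.
  by apply/row_norm_le => // -[].
rewrite vol_outer.
transitivity (\int[@lebesgue_measure R]_s
    (((r *+ 2) ^+ n)%:E * (\1_(`[- r, r]%classic) s)%:E))%E.
  apply: eq_integral => s _; rewrite indicE.
  have [sr|sr] := boolP (s \in `[- r, r]%classic).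
    rewrite mule1 -IH; congr vol.
    apply/seteqP; split => y; rewrite /cube/= vcons_norm_le//.
      by case.
    by move: sr; rewrite inE/= in_itv/= ler_norml.
  rewrite mule0 (_ : mkset _ = set0) ?volE ?preimage_set0 ?measure0//.
  apply/seteqP; split => // y; rewrite /cube/= vcons_norm_le// => -[H _].
  by move: sr; rewrite notin_setE/= in_itv/= -ler_norml.
rewrite ge0_integralZl//=.
- rewrite integral_indic// setIT /= lebesgue_measure_itv/= lte_fin.
  case: ifPn => [_|]; first by rewrite -EFinB -EFinM opprK -mulr2n exprSr.
  rewrite -leNgt => rr; have -> : r = 0 by lra.
  by rewrite mul0rn mule0 expr0n.
- exact: measurableT_comp.
- by rewrite lee_fin exprn_ge0// mulrn_wge0.
Qed.

Lemma compact_row_measurable n (A : set 'rV[R]_n) :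
  compact A -> row_measurable A.
Proof.
by move=> cA; apply: row_measurable_closed; exact: compact_closed.
Qed.

Lemma compact_sub_cube n (A : set 'rV[R]_n) :
  compact A -> exists2 r, 0 < r & A `<=` cube n r.
Proof.
by move=> /compact_bounded/pinfty_ex_gt0[M M0 HM]; exists M.
Qed.

Lemma vol_compact_fin n (A : set 'rV[R]_n) : compact A -> vol A \is a fin_num.
Proof.
move=> cA; have [r r0 Ar] := compact_sub_cube cA.
rewrite ge0_fin_numE ?vol_ge0//; apply: (@le_lt_trans _ _ (vol (cube n r))).
  apply: le_vol => //; first exact: compact_row_measurable.
  by apply: row_measurable_closed; exact: closed_cube.
by rewrite vol_cube ?ltW// ltry.
Qed.

End borel_rows.

(** * Minkowski sums with segments *)

Section convex_geometry.
Variable R : realType.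

Lemma mulmx_continuous m n (M : 'M[R]_(m, n)) :
  continuous (fun x : 'rV[R]_m => x *m M).
Proof.
have -> : (fun x : 'rV[R]_m => x *m M) = mulmxr M by [].
apply/bounded_linear_continuous/linear_boundedP.
near=> k => x.
apply/row_norm_le; first by rewrite mulr_ge0.
move=> j; rewrite mxE; apply: (le_trans (ler_norm_sum _ _ _)).
apply: (@le_trans _ _ (\sum_i `|x| * `|M i j|)).
  by apply: ler_sum => i _; rewrite normrM ler_wpM2r// row_coord_le.
rewrite -mulr_sumr mulrC ler_wpM2r//.
apply: (@le_trans _ _ (\sum_j \sum_i `|M i j|)).
  by rewrite (bigD1 j)//= lerDl sumr_ge0// => ? _; exact: sumr_ge0.
near: k; apply: nbhs_pinfty_ge; exact: num_real.
Unshelve. all: by end_near. Qed.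

Lemma convexE n (A : set 'rV[R]_n) : convex_set A <->
  forall x y t, A x -> A y -> 0 <= t <= 1 -> A (t *: x + (1 - t) *: y).
Proof.
split=> [cA x y t Ax Ay /andP[t0 t1]|cA x y l /set_mem Ax /set_mem Ay]; last first.
  by apply/mem_set; apply: cA => //; rewrite ge0 le1.
pose l : {i01 R} := Itv01 t0 t1.
by have /set_mem := cA x y l (mem_set Ax) (mem_set Ay).
Qed.

Lemma compact_mulmx m n (M : 'M[R]_(m, n)) (A : set 'rV[R]_m) :
  compact A -> compact [set x *m M | x in A].
Proof.
move=> cA; apply: continuous_compact => //.
by apply: continuous_subspaceT; exact: mulmx_continuous.
Qed.

(** The Minkowski sum of A and the segment from 0 to u. *)
Definition extrude n (A : set 'rV[R]_n) (u : 'rV[R]_n) : set 'rV[R]_n :=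
  [set z | exists x t, [/\ A x, 0 <= t <= 1 & z = x + t *: u]].

Lemma compact_extrude n (A : set 'rV[R]_n) u : compact A -> compact (extrude A u).
Proof.
move=> cA.
have -> : extrude A u =
    (fun p : 'rV[R]_n * R^o => p.1 + p.2 *: u) @` (A `*` `[0, 1]%classic).
  apply/seteqP; split => [z [x [t [Ax t01 ->]]]|_ [[x t] /= [Ax t01] <-]].
    by exists (x, t) => //; split => //=; rewrite in_itv.
  by exists x, t; split => //; move: t01; rewrite /= in_itv.
apply: continuous_compact; last by apply: compact_setX => //; exact: segment_compact.
apply: continuous_subspaceT => -[x t]; apply: cvgD; first exact: cvg_fst.
apply: cvgZr_tmp; exact: cvg_snd.
Qed.

Lemma convex_extrude n (A : set 'rV[R]_n) u :
  convex_set A -> convex_set (extrude A u).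
Proof.
move=> /convexE cA; apply/convexE.
move=> _ _ l [x [t [Ax t01 ->]]] [y [s [Ay s01 ->]]] l01.
exists (l *: x + (1 - l) *: y), (l * t + (1 - l) * s); split.
- exact: cA.
- by apply/andP; split; nra.
- by apply/rowP => i; rewrite !mxE; ring.
Qed.

Lemma sub_extrude n (A : set 'rV[R]_n) u : A `<=` extrude A u.
Proof.
by move=> x Ax; exists x, 0; rewrite scale0r addr0 lexx ler01; split.
Qed.

(** The convex hull of two translates of a convex set sweeps that set along the
    segment between the two translation vectors. *)
Lemma conv_hull_translates n (K : set 'rV[R]_n) v w : convex_set K ->
  conv_hull (translate v K `|` translate w K) = translate v (extrude K (w - v)).
Proof.
move=> cK; apply/seteqP; split.
  apply: smallest_sub.
    have := @convex_extrude n K (w - v) cK; move=> /convexE cE.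
    apply/convexE => _ _ t [x Ex <-] [y Ey <-] t01.
    exists (t *: x + (1 - t) *: y); first exact: cE.
    by rewrite !scalerDr addrACA -scalerDl subrKC scale1r.
  move=> z [[x Kx <-]|[x Kx <-]]; first by exists x => //; exact: sub_extrude.
  exists (x + (w - v)).
    by exists x, 1; rewrite scale1r lexx ler01; split.
  by apply/rowP => i; rewrite !mxE; ring.
move=> _ [_ [x [t [Kx t01 ->]]] <-] C [/convexE cC sC].
have -> : v + (x + t *: (w - v)) = t *: (w + x) + (1 - t) *: (v + x).
  by apply/rowP => i; rewrite !mxE; ring.
by apply: cC => //; apply: sC; [right|left]; exists x.
Qed.

Lemma vol_translate n (v : 'rV[R]_n) A :
  row_measurable A -> vol (translate v A) = vol A.
Proof.
move=> mA; rewrite -[RHS](vol_translation (- v) mA); congr vol.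
apply/seteqP; split => [_ [x Ax <-]|x Ax] /=; first by rewrite addrAC subrr add0r.
by exists (x - v) => //; rewrite addrC subrK.
Qed.

(** A nonempty compact interval, described by the properties that the fibres of
    a compact convex set inherit directly. *)
Definition line_body (S : set R) := [/\ compact S,
  (forall x y z, S x -> S y -> x <= z <= y -> S z) & S !=set0].

Lemma lebesgue_measure_interval_sum (S : set R) (t : R) : line_body S -> 0 <= t ->
  @lebesgue_measure R
    [set z | exists x s, [/\ S x, 0 <= s <= t & z = x + s]] =
  (@lebesgue_measure R S + t%:E)%E.
Proof.
move=> [cS iS S0] t0.
have cid := @continuous_subspaceT _ _ S idfun (fun=> cvg_id).
have [b Sb Hb] := compact_EVT_max S0 cS cid.
have [a Sa Ha] := compact_EVT_min S0 cS cid.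
have ab : a <= b by exact: Ha.
have -> : S = `[a, b]%classic.
  apply/seteqP; split => [x Sx|x]; rewrite /= in_itv/=.
    by rewrite Hb ?Ha// inE.
  by move=> xab; apply: (iS a b) => //; exact: set_mem.
have -> : [set z | exists x s,
    [/\ `[a, b]%classic x, 0 <= s <= t & z = x + s]] = `[a, b + t]%classic.
  apply/seteqP; split => [z [x [s []]]|z]; rewrite /= !in_itv/=.
    by move=> /andP[? ?] /andP[? ?] ->; apply/andP; split; lra.
  move=> /andP[az zb]; have [zb'|zb'] := leP z b.
    by exists z, 0; split; rewrite ?in_itv/= ?az ?lexx ?addr0.
  exists b, (z - b); split; rewrite ?in_itv/= ?ab ?lexx//.
    by apply/andP; split; lra.
  by rewrite addrC subrK.
rewrite !lebesgue_measure_itv/= !lte_fin.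
have [ab'|ab'] := ltP a b.
  by rewrite ifT ?EFinD; [rewrite addeAC|lra].
have -> : a = b by apply/eqP; rewrite eq_le ab ab'.
by case: ltP => [_|?]; rewrite -?EFinB ?add0e; [congr EFin|congr EFin]; lra.
Qed.

Lemma interiorP n (K : set 'rV[R]_n) z :
  interior K z <-> exists2 r, 0 < r & forall x, `|x| < r -> K (z + x).
Proof.
split.
  move=> /nbhs_ballP[r /= r0 br]; exists r => // x xr; apply: br.
  by rewrite -ball_normE /ball_/= opprD addrA subrr add0r normrN.
move=> [r r0 Kr]; apply/nbhs_ballP; exists r => //= y.
rewrite -ball_normE /ball_/= => zy; rewrite -(subrKC z y).
by apply: Kr; rewrite distrC.
Qed.

End convex_geometry.

(** * Euclidean inner product *)

Section inner_product.
Variable R : realType.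

Lemma dotE n (x y : 'rV[R]_n) : dot x y = (x *m y^T) ord0 ord0.
Proof. by rewrite mxE; apply: eq_bigr => i _; rewrite mxE. Qed.

Lemma dotDl n (x y z : 'rV[R]_n) : dot (x + y) z = dot x z + dot y z.
Proof. by rewrite !dotE mulmxDl mxE. Qed.

Lemma dotZl n a (x y : 'rV[R]_n) : dot (a *: x) y = a * dot x y.
Proof. by rewrite !dotE -scalemxAl mxE. Qed.

Lemma dotC n (x y : 'rV[R]_n) : dot x y = dot y x.
Proof. by apply: eq_bigr => i _; rewrite mulrC. Qed.

Lemma dotZr n a (x y : 'rV[R]_n) : dot y (a *: x) = a * dot y x.
Proof. by rewrite dotC dotZl dotC. Qed.

Lemma dotBl n (x y z : 'rV[R]_n) : dot (x - y) z = dot x z - dot y z.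
Proof. by rewrite dotDl -scaleN1r dotZl mulN1r. Qed.

Lemma dotBr n (x y z : 'rV[R]_n) : dot z (x - y) = dot z x - dot z y.
Proof. by rewrite dotC dotBl !(dotC z). Qed.

Lemma dot_mx11 n (x y : 'rV[R]_n) : x *m y^T = (dot x y)%:M.
Proof. by rewrite dotE -mx11_scalar. Qed.

Lemma dot_delta n (x : 'rV[R]_n) i : dot x (delta_mx ord0 i) = x ord0 i.
Proof.
rewrite /dot (bigD1 i)//= mxE !eqxx mulr1 big1 ?addr0// => j ji.
by rewrite mxE (negbTE ji) andbF mulr0.
Qed.

Lemma dot_gt0 n (x : 'rV[R]_n) : x != 0 -> 0 < dot x x.
Proof.
move=> x0; have d0 : 0 <= dot x x by apply: sumr_ge0 => i _; rewrite -expr2 sqr_ge0.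
rewrite lt_neqAle d0 andbT eq_sym; apply: contraNneq x0.
move=> /(psumr_eq0P (fun i _ => sqr_ge0 (x ord0 i) )) H.
by apply/eqP/rowP => i; rewrite mxE; have /eqP := H i isT; rewrite sqrf_eq0 => /eqP.
Qed.

Lemma polar_coordinates n (x : 'rV[R]_n) : x != 0 ->
  exists r u, [/\ 0 < r, unit_vector u & x = r *: u].
Proof.
move=> /dot_gt0 d0; pose r := Num.sqrt (dot x x).
have r0 : 0 < r by rewrite sqrtr_gt0.
exists r, (r^-1 *: x); split => //; last by rewrite scalerA divff ?scale1r// gt_eqF.
rewrite /unit_vector dotZl dotZr mulrA -expr2 exprVn sqr_sqrtr ?ltW//.
by rewrite mulVf// gt_eqF.
Qed.

Lemma unit_coord_le n (u : 'rV[R]_n) i : unit_vector u -> `|u ord0 i| <= 1.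
Proof.
rewrite /unit_vector /dot (bigD1 i)//= => uu.
rewrite -(@expr_le1 _ 2)// real_normK ?num_real// expr2 -uu lerDl.
by apply: sumr_ge0 => j _; rewrite -expr2 sqr_ge0.
Qed.

Lemma dot_unit_le n (x u : 'rV[R]_n) : unit_vector u -> dot x u <= `|x| *+ n.
Proof.
move=> uu; have -> : `|x| *+ n = \sum_(i < n) `|x| by rewrite sumr_const card_ord.
apply: ler_sum => i _.
apply: le_trans (ler_norm _) _; rewrite normrM -[leRHS]mulr1.
by rewrite ler_pM ?unit_coord_le ?row_coord_le.
Qed.

Lemma frame_perp m (u : 'rV[R]_m.+1) (B : 'M[R]_(m, m.+1)) :
  @orthonormal_frame R m.+1 u B -> u *m B^T = 0.
Proof. by move=> [_ Bu]; rewrite -[LHS]trmxK trmx_mul trmxK Bu trmx0. Qed.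

Lemma frame_orthogonal m (u : 'rV[R]_m.+1) (B : 'M[R]_(m, m.+1)) :
  unit_vector u -> @orthonormal_frame R m.+1 u B ->
  (col_mx u B : 'M[R]_(1 + m)) *m (col_mx u B)^T = 1%:M.
Proof.
move=> uu fB; have [BB Bu] := fB; rewrite tr_col_mx mul_col_row dot_mx11 uu.
by rewrite [B *m u^T]Bu BB (frame_perp fB) -scalar_mx_block.
Qed.

End inner_product.

(** * Volume of a body extruded along a direction *)

Section extrusion_volume.
Variable R : realType.
Local Notation rT := (measurableTypeR R).
Local Notation leb := (@lebesgue_measure R).

Lemma line_body_fibre n (A : set 'rV[R]_n.+1) (y : 'rV[R]_n) :
  compact A -> convex_set A -> [set s | A (vcons s y)] !=set0 ->
  line_body [set s | A (vcons s y)].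
Proof.
move=> cA /convexE vA A0; split => //.
- have [r r0 Ar] := compact_sub_cube cA.
  apply: (@subclosed_compact R^o _ `[- r, r]%classic).
  + apply: (@closed_comp R^o 'rV[R]_n.+1 (fun s => vcons s y) A).
      move=> s _; rewrite (_ : (fun s => _) =
          (fun s : R^o => s *: vcons 1 0 + vcons 0 y)).
        by apply: cvgD; [apply: cvgZr_tmp; exact: cvg_id|exact: cvg_cst].
      by apply/funext => z; exact: vcons_vec.
    by apply: compact_closed => //; exact: norm_hausdorff.
  + exact: segment_compact.
  + move=> s /Ar; rewrite /cube/= vcons_norm_le; last exact: ltW.
    move=> -[sr _].
    by rewrite /= in_itv/= -ler_norml.
- move=> a b z Aa Ab /andP[az zb].
  have [ab|ab] := leP b a.
    by have -> : z = a by apply/eqP; rewrite eq_le az (le_trans zb).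
  have ba : 0 < b - a by rewrite subr_gt0.
  have := vA _ _ ((b - z) / (b - a)) Aa Ab.
  rewrite [X in A X](_ : _ = vcons z y).
    by apply; rewrite divr_ge0 ?subr_ge0 ?(ltW ab)//= ler_pdivrMr// mul1r; lra.
  rewrite !vconsZ vconsD -scalerDl subrKC scale1r; congr vcons.
  by field; lra.
Qed.

Definition shadow n (A : set 'rV[R]_n.+1) : set 'rV[R]_n :=
  [set y | exists s, A (vcons s y)].

Lemma compact_shadow n (A : set 'rV[R]_n.+1) : compact A -> compact (shadow A).
Proof.
have E s (y : 'rV[R]_n) : vcons s y *m (col_mx 0 1%:M : 'M[R]_(1 + n, n)) = y.
  by rewrite /vcons (@mul_row_col R 1 1 n) mulmx0 mulmx1 add0r.
move=> cA; have -> : shadow A =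
    [set x *m (col_mx 0 1%:M : 'M[R]_(1 + n, n)) | x in A].
  apply/seteqP; split => [y [s As]|_ [x Ax <-]]; first by exists (vcons s y).
  by have [s [y xE]] := vconsP x; rewrite xE E; exists s; rewrite -xE.
exact: compact_mulmx.
Qed.

(** Each line parallel to the first axis that meets A meets it in an interval,
    which the extrusion prolongs by t; the other lines contribute nothing. *)
Lemma vol_extrude_head n (A : set 'rV[R]_n.+1) (t : R) :
  compact A -> convex_set A -> 0 <= t ->
  vol (extrude A (vcons t 0)) = (vol A + t%:E * vol (shadow A))%E.
Proof.
move=> cA vA t0.
have mA := compact_row_measurable cA.
have mE := compact_row_measurable (compact_extrude (u := vcons t 0) cA).
have mS := compact_row_measurable (compact_shadow cA).
rewrite !vol_inner//.
have [P PE mP] : exists2 P : set (n.-tuple rT),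
    P = @row_of_tuple R n @^-1` shadow A & measurable P by eexists.
have mI : measurable_fun [set: n.-tuple rT] (fun z => (\1_P z)%:E : \bar R).
  exact: measurableT_comp.
have -> : vol (shadow A) = (\int[@lebesgue_tuple R n]_z (\1_P z)%:E)%E.
  by rewrite integral_indic// setIT PE.
rewrite -ge0_integralZl//=.
rewrite -ge0_integralD//=; last 3 first.
- have /(measurable_fun_ysection leb) := measurable_cut mA.
  congr measurable_fun; apply/funext => z /=; congr lebesgue_measure.
  by apply/seteqP; split => s; rewrite /ysection/= inE.
- by move=> z _; rewrite mule_ge0// lee_fin.
- exact: measurable_funeM.
apply: eq_integral => z _; set y := row_of_tuple z.
have EE : [set s | extrude A (vcons t 0) (vcons s y)] =
    [set w | exists x s, [/\ A (vcons x y), 0 <= s <= t & w = x + s]].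
  apply/seteqP; split => [w [x [l [Ax l01]]]|w [x [s [Ax s0t ->]]]].
    have [a [b xE]] := vconsP x; rewrite xE in Ax *.
    rewrite vconsZ scaler0 vconsD addr0 => wE.
    have [-> yb] := vcons_inj wE.
    exists a, (l * t); split => //; first by rewrite yb.
    by apply/andP; split; nra.
  have [st0|st0] := eqVneq t 0.
    exists (vcons x y), 0; split => //; first by rewrite lexx ler01.
    by rewrite scale0r addr0; congr vcons; lra.
  have tp : 0 < t by rewrite lt_neqAle eq_sym st0.
  exists (vcons x y), (s / t); split => //.
    by case/andP: s0t => s0 st; rewrite divr_ge0//= ler_pdivrMr// mul1r.
  by rewrite vconsZ scaler0 vconsD addr0 divfK.
rewrite EE indicE PE.
have [Ay|nAy] := pselect (shadow A y).
  rewrite mem_set// mule1.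
  apply: (@lebesgue_measure_interval_sum R [set s | A (vcons s y)]) => //.
  exact: line_body_fibre.
rewrite memNset// mule0 adde0; congr lebesgue_measure.
by apply/seteqP; split => [w [x [s [Ax _ _]]]|w Aw]; case: nAy;
  [exists x|exists w].
Qed.

(** Completing the frame by u gives an orthogonal matrix, hence a
    volume-preserving change of coordinates that takes u to the first axis. *)
Lemma vol_extrude_frame m (K : set 'rV[R]_m.+1) (u : 'rV[R]_m.+1)
    (B : 'M[R]_(m, m.+1)) (t : R) :
  compact K -> convex_set K -> unit_vector u -> @orthonormal_frame R m.+1 u B ->
  0 <= t ->
  vol (extrude K (t *: u)) =
  (vol K + t%:E * vol [set y : 'rV[R]_m |
     [set orthogonal_projection u x | x in K] (y *m B)])%E.
Proof.
move=> cK vK uu [BB Bu] t0.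
pose Q : 'M[R]_(1 + m) := col_mx u B.
have QQ : Q *m Q^T = 1%:M by exact: frame_orthogonal.
have QQ' : Q^T *m Q = 1%:M by apply: mulmx1C.
pose A := [set z : 'rV[R]_m.+1 | K (z *m Q)].
have AE : A = [set x *m Q^T | x in K].
  apply/seteqP; split => [z Az|_ [x Kx <-]]; last by rewrite /A/= -mulmxA QQ' mulmx1.
  by exists (z *m Q) => //; rewrite -mulmxA QQ mulmx1.
have cA : compact A by rewrite AE; exact: compact_mulmx.
have vA : convex_set A.
  apply/convexE => x y l Ax Ay l01; rewrite /A/= mulmxDl -!scalemxAl.
  by move/convexE : vK; apply.
have vQ s y : vcons s y *m Q = s *: u + y *m B.
  by rewrite /vcons /Q (@mul_row_col R 1 1 m) mul_scalar_mx.
have mK := compact_row_measurable cK.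
rewrite -[in RHS](vol_orthogonal QQ mK) -/A.
have mE := compact_row_measurable (compact_extrude (u := t *: u) cK).
rewrite -(vol_orthogonal QQ mE).
have -> : [set x | extrude K (t *: u) (x *m Q)] = extrude A (vcons t 0).
  have tu : vcons t 0 *m Q = t *: u by rewrite vQ mul0mx addr0.
  apply/seteqP; split => [z [x [l [Kx l01 zE]]]|_ [x [l [Ax l01 ->]]]].
    exists (x *m Q^T), l; split => //; first by rewrite AE; exists x.
    rewrite -[z]mulmx1 -QQ mulmxA zE -tu mulmxDl -!scalemxAl -mulmxA QQ mulmx1//.
  by exists (x *m Q), l; split => //; rewrite mulmxDl -scalemxAl tu.
rewrite vol_extrude_head//; congr (_ + _ * vol _)%E.
apply/seteqP; split => [y [s]|y [x Kx]]; rewrite /A/= ?vQ.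
  move=> Ks; exists (s *: u + y *m B) => //; rewrite /orthogonal_projection.
  suff -> : dot (s *: u + y *m B) u = s by rewrite addrC addKr.
  by rewrite dotDl dotZl uu (dotE (y *m B)) -mulmxA Bu mulmx0 mxE addr0 mulr1.
move=> xE; exists (dot x u); rewrite /A/= vQ -xE /orthogonal_projection.
by rewrite addrC subrK.
Qed.

End extrusion_volume.

(** * Projections along a direction *)

Section brightness_function.
Variable R : realType.

(** The Householder reflection that exchanges the first basis vector and u maps
    the remaining basis vectors to an orthonormal basis of the hyperplane. *)
Lemma orthonormal_frame_exists m (u : 'rV[R]_m.+1) : unit_vector u ->
  exists B, @orthonormal_frame R m.+1 u B.
Proof.
move=> uu.
suff [Q [QQ uQ]] : exists Q : 'M[R]_m.+1, Q *m Q^T = 1%:M /\ u *m Q^T = vcons 1 0.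
  pose J : 'M[R]_(m, 1 + m) := row_mx 0 1%:M.
  exists (J *m Q); split.
    rewrite trmx_mul mulmxA -(mulmxA J) QQ mulmx1 /J tr_row_mx mul_row_col.
    by rewrite trmx1 mulmx1 mul0mx add0r.
  rewrite -mulmxA -[Q *m _]trmxK trmx_mul trmxK uQ /J /vcons.
  by rewrite (@tr_row_mx R 1 1 m) (@mul_row_col R m 1 m 1) mul0mx trmx0 mulmx0 addr0.
pose e : 'rV[R]_m.+1 := vcons 1 0.
have ee : dot e e = 1.
  rewrite dotE /e /vcons (@tr_row_mx R 1 1 m) (@mul_row_col R 1 1 m 1).
  by rewrite mul0mx addr0 tr_scalar_mx mul1mx mxE eqxx.
have [->|ue] := eqVneq u e; first by exists 1%:M; rewrite trmx1 !mulmx1.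
pose w := u - e; have w0 : 0 < dot w w by rewrite dot_gt0// subr_eq0.
pose H : 'M[R]_m.+1 := 1%:M - (2 / dot w w) *: (w^T *m w).
have HT : H^T = H by rewrite /H linearB/= linearZ/= trmx1 trmx_mul trmxK.
have xH (x : 'rV[R]_m.+1) : x *m H = x - (2 * dot x w / dot w w) *: w.
  rewrite /H mulmxBr mulmx1 -scalemxAr mulmxA dot_mx11 mul_scalar_mx scalerA.
  by congr (_ - _ *: _); ring.
have dw : dot w w = 2 * (1 - dot u e).
  by rewrite /w dotBl !dotBr uu ee (dotC e u); ring.
have uw : dot u w = dot w w / 2.
  by rewrite dw /w dotBr uu; field.
exists H; split; last first.
  rewrite HT xH uw (_ : 2 * _ / _ = 1); last by field; rewrite gt_eqF.
  by rewrite scale1r /w opprB addrC subrK.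
have wH : w *m H = - w.
  rewrite xH -mulrA divff ?gt_eqF// mulr1.
  by apply/rowP => i; rewrite !mxE; ring.
rewrite HT; apply/row_matrixP => i; rewrite row_mul -[H in row i H]mul1mx row_mul.
rewrite (xH (row i _)) mulmxBl -scalemxAl wH scalerN opprK xH.
by rewrite -addrA addNr addr0.
Qed.

Lemma frame_resolution m (u : 'rV[R]_m.+1) (B : 'M[R]_(m, m.+1)) :
  unit_vector u -> @orthonormal_frame R m.+1 u B ->
  u *m B^T = 0 /\ u^T *m u + B^T *m B = 1%:M.
Proof.
move=> uu fB; split; first exact: frame_perp fB.
by have := mulmx1C (frame_orthogonal uu fB); rewrite tr_col_mx mul_row_col.
Qed.

Lemma frame_projection m (u : 'rV[R]_m.+1) (B : 'M[R]_(m, m.+1))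
    (K : set 'rV[R]_m.+1) :
  unit_vector u -> @orthonormal_frame R m.+1 u B ->
  [set y : 'rV[R]_m | [set orthogonal_projection u x | x in K] (y *m B)] =
  [set x *m B^T | x in K].
Proof.
move=> uu fB; have [BB Bu] := fB; have [uB QQ] := frame_resolution uu fB.
have xE (x : 'rV[R]_m.+1) : orthogonal_projection u x = x *m B^T *m B.
  rewrite /orthogonal_projection -mul_scalar_mx -dot_mx11 -[X in X - _]mulmx1 -QQ.
  by rewrite mulmxDr !mulmxA addrAC subrr add0r.
apply/seteqP; split => [y [x Kx]|_ [x Kx <-]]; last by exists x; rewrite ?xE.
rewrite xE => /(congr1 (mulmx^~ B^T)); rewrite -!mulmxA BB !mulmx1 => xy.
by exists x.
Qed.

Lemma hyperplane_volE m (u : 'rV[R]_m.+1) (K : set 'rV[R]_m.+1) :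
  unit_vector u ->
  exists2 B, @orthonormal_frame R m.+1 u B &
  hyperplane_vol u [set orthogonal_projection u x | x in K] =
    vol [set x *m B^T | x in K].
Proof.
move=> uu; have fB := getPex (orthonormal_frame_exists uu).
by eexists; [exact: fB|rewrite -(frame_projection K uu fB)].
Qed.

(** The increase of volume under the Minkowski sum with a segment; for a convex
    body and a unit vector it is the volume of the projection along it. *)
Definition brightness n (K : set 'rV[R]_n) (x : 'rV[R]_n) : R :=
  fine (vol (extrude K x)) - fine (vol K).

Section fixed_body.
Variables (m : nat) (K : set 'rV[R]_m.+1).
Hypotheses (cK : compact K) (vK : convex_set K).

Lemma vol_extrude_fin x : vol (extrude K x) = (fine (vol K) + brightness K x)%:E.
Proof.
by rewrite /brightness subrKC fineK// vol_compact_fin//; exact: compact_extrude.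
Qed.

Lemma hyperplane_vol_fin u : unit_vector u ->
  hyperplane_vol u [set orthogonal_projection u x | x in K] \is a fin_num.
Proof.
move=> uu; have [B _ ->] := hyperplane_volE K uu.
by apply: vol_compact_fin; exact: compact_mulmx.
Qed.

Lemma brightness_polar u t : unit_vector u -> 0 <= t -> brightness K (t *: u) =
  t * fine (hyperplane_vol u [set orthogonal_projection u x | x in K]).
Proof.
move=> uu t0; have [B fB E] := hyperplane_volE K uu.
have := hyperplane_vol_fin uu; rewrite E => fin.
rewrite /brightness (vol_extrude_frame cK vK uu fB t0).
rewrite (frame_projection K uu fB).
have fK := vol_compact_fin cK.
by rewrite fineD ?fin_numM// fineM// addrC addKr.
Qed.

Lemma brightness_unit u : unit_vector u -> (brightness K u)%:E =
  hyperplane_vol u [set orthogonal_projection u x | x in K].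
Proof.
move=> uu; rewrite -{1}(scale1r u) brightness_polar// mul1r fineK//.
exact: hyperplane_vol_fin.
Qed.

Lemma brightness0 : brightness K 0 = 0.
Proof.
rewrite /brightness (_ : extrude K 0 = K) ?subrr//.
apply/seteqP; split; last exact: sub_extrude.
by move=> z [x [t [Kx _ ->]]]; rewrite scaler0 addr0.
Qed.

Lemma brightnessZ t x : 0 <= t -> brightness K (t *: x) = t * brightness K x.
Proof.
move=> t0; have [->|x0] := eqVneq x 0; first by rewrite scaler0 brightness0 mulr0.
have [r [u [r0 uu ->]]] := polar_coordinates x0.
by rewrite scalerA !brightness_polar ?mulrA// ?mulr_ge0// ltW.
Qed.

End fixed_body.

Lemma le_brightness m (K K' : set 'rV[R]_m.+1) x :
  compact K -> convex_set K -> compact K' -> convex_set K' -> K `<=` K' ->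
  brightness K x <= brightness K' x.
Proof.
move=> cK vK cK' vK' KK'; have [->|x0] := eqVneq x 0; first by rewrite !brightness0.
have [r [u [r0 uu ->]]] := polar_coordinates x0.
rewrite (brightnessZ cK vK) ?(ltW r0)// (brightnessZ cK' vK') ?(ltW r0)//.
apply: ler_wpM2l; first exact: ltW.
have fB := getPex (orthonormal_frame_exists uu).
rewrite -lee_fin !brightness_unit//; apply: le_vol.
- rewrite (frame_projection K uu fB); apply: compact_row_measurable.
  exact: compact_mulmx.
- rewrite (frame_projection K' uu fB); apply: compact_row_measurable.
  exact: compact_mulmx.
- by move=> y [z Kz zE]; exists z => //; exact: KK'.
Qed.

End brightness_function.

(** * The brightness is sublinear *)

Section sublinearity.
Variable R : realType.

Definition homothet n (s : R) (c : 'rV[R]_n) (A : set 'rV[R]_n) :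
    set 'rV[R]_n :=
  [set s *: x + c | x in A].

Lemma homothetE n s c (A : set 'rV[R]_n) : s != 0 ->
  homothet s c A = [set x | A (x *m (s^-1)%:M + - (s^-1 *: c))].
Proof.
move=> s0; apply/seteqP; split => [_ [x Ax <-]|x Ax] /=.
  by rewrite mul_mx_scalar scalerDr scalerA mulVf// scale1r addrK.
exists (x *m (s^-1)%:M + - (s^-1 *: c)) => //.
by rewrite mul_mx_scalar scalerBr !scalerA divff// !scale1r subrK.
Qed.

Lemma row_measurable_homothet n s c (A : set 'rV[R]_n) : s != 0 ->
  row_measurable A -> row_measurable (homothet s c A).
Proof. by move=> s0 mA; rewrite homothetE//; exact: row_measurable_affine. Qed.

Lemma vol_homothet n s c (A : set 'rV[R]_n) : 0 < s -> row_measurable A ->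
  vol (homothet s c A) = ((s ^+ n)%:E * vol A)%E.
Proof.
move=> s0 mA; have s0' : s != 0 by rewrite gt_eqF.
rewrite (vol_dilation s0 (row_measurable_homothet c s0' mA)); congr (_ * _)%E.
rewrite -[RHS](vol_translation (- (s^-1 *: c)) mA) homothetE//; congr vol.
apply/seteqP; split => x /=;
  by rewrite mul_mx_scalar scalerA mulVf// scale1r.
Qed.

Lemma extrude_homothet n s c (K : set 'rV[R]_n) x : s != 0 ->
  extrude (homothet s c K) x = homothet s c (extrude K (s^-1 *: x)).
Proof.
move=> s0; apply/seteqP.
split => [_ [_ [t [[z Kz <-] t01 ->]]]|_ [_ [z [t [Kz t01 ->]]] <-]].
  exists (z + t *: (s^-1 *: x)); first by exists z, t.
  by apply/rowP => i; rewrite !mxE; field.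
exists (s *: z + c), t; split => //; first by exists z.
by apply/rowP => i; rewrite !mxE; field.
Qed.

Lemma compact_homothet n s c (A : set 'rV[R]_n) :
  compact A -> compact (homothet s c A).
Proof.
move=> cA; apply: continuous_compact => //; apply: continuous_subspaceT.
have -> : (fun x : 'rV[R]_n => s *: x + c) = ( *:%R s) \+ cst c by [].
move=> x; apply: (@continuousD R); first exact: scaler_continuous.
exact: cst_continuous.
Qed.

Lemma convex_homothet n s c (A : set 'rV[R]_n) :
  convex_set A -> convex_set (homothet s c A).
Proof.
move=> /convexE cA; apply/convexE => _ _ t [x Ax <-] [y Ay <-] t01.
exists (t *: x + (1 - t) *: y); first exact: cA.
by apply/rowP => i; rewrite !mxE; ring.
Qed.

Lemma brightness_homothet m s c (K : set 'rV[R]_m.+1) x : 0 < s ->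
  compact K -> convex_set K ->
  brightness (homothet s c K) x = s ^+ m * brightness K x.
Proof.
move=> s0 cK vK; have s0' : s != 0 by rewrite gt_eqF.
rewrite {1}/brightness extrude_homothet// !vol_homothet//; last 2 first.
- exact: compact_row_measurable.
- by apply: compact_row_measurable; exact: compact_extrude.
rewrite vol_extrude_fin// !fineM// ?vol_compact_fin//=.
rewrite (brightnessZ cK vK) ?invr_ge0 ?ltW// mulrDr addrAC subrr add0r.
by rewrite exprSr mulrA mulfK.
Qed.

(** A linear rate for the convergence of (1 + tC)^m to 1 as t tends to 0. *)
Lemma expr_affine_bound (C : R) m : 0 <= C ->
  exists2 M, 0 <= M & forall t, 0 <= t <= 1 -> (1 + t * C) ^+ m <= 1 + t * M.
Proof.
move=> C0; elim: m => [|m [M M0 IH]].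
  by exists 0 => // t _; rewrite expr0 mulr0 addr0.
exists (C + M + C * M); first by rewrite !addr_ge0// mulr_ge0.
move=> t t01; rewrite exprS.
apply: (@le_trans _ _ ((1 + t * C) * (1 + t * M))).
  apply: ler_wpM2l; last exact: IH.
  by case/andP: t01 => t0 _; rewrite addr_ge0// mulr_ge0.
case/andP: t01 => t0 t1; rewrite -subr_ge0.
rewrite (_ : _ - _ = t * (1 - t) * (C * M)); last by ring.
by rewrite !mulr_ge0// subr_ge0.
Qed.

(** Thickening K by a short segment t u stays inside a homothet of K of ratio
    1 + tC, because K contains a ball; hence the brightness of the thickened
    body is at most that of K times a factor that tends to 1 as t tends to 0.
    Extruding along t u and then along t v covers the extrusion along
    t (u + v). *)
Lemma brightnessD m (K : set 'rV[R]_m.+1) u v : convex_body K ->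
  brightness K (u + v) <= brightness K u + brightness K v.
Proof.
move=> [cK vK [c /interiorP[r r0 Kc]]].
(* C is chosen so that a multiple of u of norm at most |u| / C < r can be
   absorbed by the ball of radius r inside K *)
pose C := (`|u| + 1) / r.
have C0 : 0 < C by rewrite divr_gt0// ltr_wpDl.
have bound t : 0 < t <= 1 ->
    brightness K (u + v) <= brightness K u + (1 + t * C) ^+ m * brightness K v.
  move=> /andP[t0 t1].
  have tC : 0 < 1 + t * C by rewrite addr_gt0// mulr_gt0.
  set E := extrude K (t *: u).
  have cE : compact E by exact: compact_extrude.
  have vE : convex_set E by exact: convex_extrude.
  have sub : E `<=` homothet (1 + t * C) (- (t * C) *: c) K.
    move=> _ [k [l [Kk /andP[l0 l1] ->]]].
    pose p := c + (l / C) *: u.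
    have Kp : K p.
      have lC : 0 <= l / C := divr_ge0 l0 (ltW C0).
      apply: Kc; rewrite normrZ (ger0_norm lC).
      rewrite mulrAC ltr_pdivrMr// (_ : r * C = `|u| + 1).
        by apply: (@le_lt_trans _ _ `|u|); rewrite ?ltrDl// ler_piMl.
      by rewrite /C mulrCA divff ?mulr1// gt_eqF.
    pose a := (1 + t * C)^-1.
    exists (a *: k + (1 - a) *: p).
      move/convexE : (vK); apply => //.
      by rewrite invr_ge0 (ltW tC)/= invf_le1// lerDl mulr_ge0// ltW.
    apply/rowP => i; rewrite /a /p !mxE; field.
    by rewrite !gt_eqF.
  have h1 : brightness E v <= (1 + t * C) ^+ m * brightness K v.
    rewrite -(brightness_homothet (- (t * C) *: c) v tC cK vK).
    apply: (@le_brightness _ m E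
      (homothet (1 + t * C) (- (t * C) *: c) K)) => //.
      exact: compact_homothet.
    exact: convex_homothet.
  have h2 : brightness K (t *: (u + v)) <=
      brightness K (t *: u) + brightness E (t *: v).
    have : (vol (extrude K (t *: (u + v))) <= vol (extrude E (t *: v)))%E.
      apply: le_vol;
        try by apply: compact_row_measurable; exact: compact_extrude.
      move=> _ [k [l [Kk l01 ->]]]; exists (k + l *: (t *: u)), l; split => //.
        by exists k, l.
      by rewrite -addrA !scalerDr.
    rewrite !vol_extrude_fin// lee_fin.
    by rewrite /= -addrA lerD2l.
  move: h2; rewrite !(brightnessZ cK vK) ?(ltW t0)//.
  rewrite (brightnessZ cE vE) ?(ltW t0)//.
  rewrite -mulrDr ler_pM2l// => /le_trans; apply; exact: lerD.
have [M M0 HM] := expr_affine_bound m (ltW C0).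
have bv0 : 0 <= brightness K v.
  rewrite subr_ge0 fine_le ?vol_compact_fin//; first exact: compact_extrude.
  apply: le_vol; [exact: compact_row_measurable| |exact: sub_extrude].
  by apply: compact_row_measurable; exact: compact_extrude.
apply/ler_addgt0Pr => e e0.
pose D := M * brightness K v + 1; have D0 : 0 < D by rewrite ltr_wpDl// mulr_ge0.
pose t := Num.min 1 (e / D).
have t0 : 0 < t by rewrite lt_min ltr01/= divr_gt0.
have t1 : t <= 1 by rewrite ge_min lexx.
have tD : t * D <= e by rewrite -ler_pdivlMr// ge_min lexx orbT.
have := bound t; rewrite t0 t1 => /(_ isT) /le_trans; apply.
rewrite -[leRHS]addrA lerD2l.
have := HM t; rewrite t1 (ltW t0) => /(_ isT) HMt.
apply: (le_trans (ler_wpM2r bv0 HMt)).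
by rewrite mulrDl mul1r lerD2l -mulrA (le_trans _ tD)// ler_pM2l// lerDl.
Qed.

(** A body that contains a ball of radius r projects onto a set that contains a
    cube whose size depends on r and the dimension only. *)
Lemma brightness_lower_bound m (K : set 'rV[R]_m.+1) : convex_body K ->
  exists2 d, 0 < d & forall u, unit_vector u -> d <= brightness K u.
Proof.
move=> [cK vK [c /interiorP[r r0 Kc]]].
pose rho := r / m.+1%:R.
have rho0 : 0 < rho by rewrite divr_gt0.
exists ((rho *+ 2) ^+ m); first by rewrite exprn_gt0// pmulrn_lgt0.
move=> u uu; rewrite -lee_fin brightness_unit//.
have [B [BB Bu] ->] := hyperplane_volE K uu.
rewrite -(vol_cube m (ltW rho0)).
have mc := row_measurable_closed (@closed_cube R m rho).
rewrite -(vol_translate (c *m B^T) mc).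
apply: le_vol.
- rewrite (_ : translate _ _ = homothet 1 (c *m B^T) (@cube R m rho)).
    by apply: row_measurable_homothet => //; exact: oner_neq0.
  by apply/seteqP; split => _ [x Ax <-]; exists x => //; rewrite scale1r addrC.
- by apply: compact_row_measurable; exact: compact_mulmx.
move=> _ [y yr <-]; exists (c + y *m B); last by rewrite mulmxDl -mulmxA BB mulmx1.
apply: Kc; have B1 i j : `|B i j| <= 1.
  have -> : B i j = row i B ord0 j by rewrite mxE.
  apply: unit_coord_le; rewrite /unit_vector.
  have := congr1 (fun M : 'M[R]_m => M i i) BB.
  rewrite !mxE eqxx mulr1n => BBi; rewrite -[RHS]BBi.
  by apply: eq_bigr => k _; rewrite !mxE.
apply: (@le_lt_trans _ _ (m%:R * rho)); last first.
  by rewrite /rho mulrCA gtr_pMr// ltr_pdivrMr// mul1r ltr_nat.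
apply/row_norm_le; first by rewrite mulr_ge0// ltW.
move=> j; rewrite mxE (le_trans (ler_norm_sum _ _ _))//.
apply: (@le_trans _ _ (\sum_(i < m) rho)).
  apply: ler_sum => i _; rewrite normrM -[leRHS]mulr1 ler_pM//.
  by apply: le_trans yr; exact: row_coord_le.
by rewrite sumr_const card_ord mulr_natl.
Qed.

End sublinearity.

(** * Linear functionals below a sublinear function *)

Section hahn_banach.
Variables (R : realType) (V : lmodType R).

Definition sublinear (p : V -> R) :=
  (forall x y, p (x + y) <= p x + p y) /\
  (forall t x, 0 <= t -> p (t *: x) = t * p x).

(** The largest sublinear function below p that agrees with p at a and is linear
    on the line of a. *)
Definition linearize (p : V -> R) (a x : V) : R :=
  inf [set p (x + t *: a) - t * p a | t in [set t | 0 <= t]].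

Variable p : V -> R.
Hypothesis sp : sublinear p.

Lemma sublinear0 : p 0 = 0.
Proof. by have [_ H] := sp; rewrite -(scale0r 0) H// mul0r. Qed.

Let slope_set a x := [set p (x + t *: a) - t * p a | t in [set t | 0 <= t]].

Let slope_has_inf a x : has_inf (slope_set a x).
Proof.
have [pD pZ] := sp; split.
  by exists (p (x + 0 *: a) - 0 * p a); exists 0 => /=.
exists (- p (- x)) => _ [t /= t0 <-]; have := pD (x + t *: a) (- x).
by rewrite addrAC subrr add0r pZ//; lra.
Qed.

Let linearize_le a x t : 0 <= t -> linearize p a x <= p (x + t *: a) - t * p a.
Proof. by move=> t0; apply: ge_inf; [have [] := slope_has_inf a x|exists t]. Qed.

Let linearize_approx a x e : 0 < e ->
  exists2 t, 0 <= t & p (x + t *: a) - t * p a < linearize p a x + e.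
Proof.
move=> e0; have [_ [t t0 <-] H] := inf_adherent e0 (slope_has_inf a x).
by exists t.
Qed.

Lemma linearize_below a x : linearize p a x <= p x.
Proof. by have := linearize_le a x (lexx 0); rewrite scale0r addr0 mul0r subr0. Qed.

Lemma linearize_sublinear a : sublinear (linearize p a).
Proof.
have [pD pZ] := sp.
have hD x y : linearize p a (x + y) <= linearize p a x + linearize p a y.
  apply/ler_addgt0Pr => e e0; have e2 : 0 < e / 2 by rewrite divr_gt0.
  have [t t0 Ht] := linearize_approx a x e2.
  have [s s0 Hs] := linearize_approx a y e2.
  have := linearize_le a (x + y) (addr_ge0 t0 s0).
  have := pD (x + t *: a) (y + s *: a).
  by rewrite addrACA -scalerDl mulrDl; lra.
have hZ t x : 0 < t -> linearize p a (t *: x) <= t * linearize p a x.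
  move=> t0; apply/ler_addgt0Pr => e e0.
  have [s s0 Hs] := linearize_approx a x (divr_gt0 e0 t0).
  have := linearize_le a (t *: x) (mulr_ge0 (ltW t0) s0).
  rewrite -scalerA -scalerDr pZ ?(ltW t0)// => /le_trans; apply.
  rewrite -mulrA -mulrBr; apply: (le_trans (ler_wpM2l (ltW t0) (ltW Hs))).
  by rewrite mulrDr mulrCA divff ?mulr1// gt_eqF.
split => // t x; rewrite le_eqVlt => /predU1P[<-|t0].
  rewrite scale0r mul0r; apply/eqP; rewrite eq_le -{1}sublinear0 linearize_below/=.
  by have := hD 0 0; rewrite addr0; lra.
apply/eqP; rewrite eq_le hZ//=.
have := hZ t^-1 (t *: x).
rewrite invr_gt0 scalerA mulVf ?gt_eqF// scale1r => /(_ t0).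
by rewrite mulrC ler_pdivlMr// mulrC.
Qed.

Lemma linearize_eq a b : p (- b) = - p b -> linearize p a b = p b.
Proof.
have sl := linearize_sublinear a; move=> pb.
apply/eqP; rewrite eq_le linearize_below/=.
have := linearize_below a (- b); rewrite pb => H.
have [H2 _] := sl; have := H2 b (- b); rewrite subrr.
have -> : linearize p a 0 = 0.
  by rewrite -(scale0r 0); have [_ ->] := sl; rewrite ?mul0r.
lra.
Qed.

Lemma linearize_line a : linearize p a a = p a /\ linearize p a (- a) = - p a.
Proof.
have [H2 HZ] := linearize_sublinear a.
have := linearize_le a (- a) (ler01); rewrite scale1r addNr mul1r sublinear0.
have := linearize_below a a; have := H2 a (- a); rewrite subrr.
have -> : linearize p a 0 = 0 by rewrite -(scale0r 0) HZ ?mul0r.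
by move=> *; split; apply/eqP; rewrite eq_le; apply/andP; split; lra.
Qed.

End hahn_banach.

Section hahn_banach_rows.
Variable R : realType.

(** Linearizing along one vector after the other: linearity along earlier vectors
    survives since a sublinear function below p coincides with p on every line
    where p is linear. *)
Lemma sublinear_linear_along (V : lmodType R) (p : V -> R) (s : seq V) :
  sublinear p ->
  exists q, [/\ sublinear q, (forall x, q x <= p x),
    (forall b, p (- b) = - p b -> q b = p b) &
    forall b, b \in s -> q (- b) = - q b].
Proof.
elim: s p => [|a s IH] p sp; first by exists p; split.
have [q [sq qp qe qs]] := IH _ (linearize_sublinear sp a).
have [la lNa] := linearize_line sp a.
exists q; split => //.
- by move=> x; apply: le_trans (qp x) _; exact: linearize_below.
- move=> b pb; have E : linearize p a b = p b by exact: linearize_eq.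
  have EN : linearize p a (- b) = p (- b).
    by apply: linearize_eq => //; rewrite opprK pb opprK.
  by rewrite qe ?E// EN.
- move=> b; rewrite inE => /predU1P[->|/qs//].
  have E : linearize p a (- a) = - linearize p a a by rewrite la lNa.
  by rewrite (qe a E) (qe (- a)) ?E// !opprK.
Qed.

(** A sublinear function that is linear along u and all basis vectors is linear;
    starting with u preserves the value at u. *)
Lemma hahn_banach_row n (p : 'rV[R]_n -> R) u : sublinear p ->
  exists2 x : 'rV[R]_n, dot x u = p u & forall y, dot x y <= p y.
Proof.
move=> sp; have slu := linearize_sublinear sp u.
have [lu lNu] := linearize_line sp u.
have [q [[qD qZ] qp qe qs]] := sublinear_linear_along
  [seq delta_mx ord0 i | i : 'I_n] slu.
have q0 : q 0 = 0 by rewrite -(scale0r 0) qZ// mul0r.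
have qN x : - q x <= q (- x) by have := qD x (- x); rewrite subrr q0; lra.
have qlin y : q y = dot (\row_i q (delta_mx ord0 i)) y.
  rewrite {1}(row_sum_delta y).
  suff [] : q (\sum_j y ord0 j *: delta_mx ord0 j) =
      dot (\row_i q (delta_mx ord0 i)) y /\
    q (- \sum_j y ord0 j *: delta_mx ord0 j) =
      - dot (\row_i q (delta_mx ord0 i)) y by [].
  rewrite /dot; elim/big_ind2 : _ => [|x1 x2 y1 y2 [Hx Hx'] [Hy Hy']|i _].
  - by rewrite oppr0 q0 oppr0.
  - rewrite opprD; have := qD x2 y2; have := qD (- x2) (- y2).
    have := qN (x2 + y2); rewrite opprD => *.
    by split; apply/eqP; rewrite eq_le; apply/andP; split; lra.
  - rewrite !mxE; have Hd : q (- delta_mx ord0 i) = - q (delta_mx ord0 i).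
      by apply: qs; apply/mapP; exists i; rewrite ?mem_enum.
    have [y0|/ltW y0] := leP 0 (y ord0 i).
      by rewrite -scalerN !qZ// Hd mulrN mulrC.
    have ny0 : 0 <= - y ord0 i by rewrite oppr_ge0.
    have -> : y ord0 i *: delta_mx ord0 i =
        (- y ord0 i) *: - (delta_mx ord0 i : 'rV[R]_n).
      by rewrite scaleNr scalerN opprK.
    by rewrite -scalerN opprK !qZ// Hd; split; ring.
exists (\row_i q (delta_mx ord0 i)); first by rewrite -qlin (qe u) lu// lNu.
by move=> y; rewrite -qlin (le_trans (qp y))//; exact: linearize_below.
Qed.

End hahn_banach_rows.

(** * The projection body and its polar *)

Section projection_body.
Variable R : realType.

Lemma brightness_sublinear m (K : set 'rV[R]_m.+1) : convex_body K ->
  sublinear (brightness K).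
Proof.
move=> bK; split => [x y|t x t0]; first exact: brightnessD.
by case: bK => cK vK _; exact: brightnessZ.
Qed.

Lemma closed_halfspace n (u : 'rV[R]_n) (a : R) : closed [set x | dot x u <= a].
Proof.
have -> : [set x | dot x u <= a] =
    (fun x : 'rV[R]_n => (x *m u^T) ord0 ord0) @^-1` [set t | t <= a].
  by apply/seteqP; split => x /=; rewrite dotE.
apply: (@closed_comp _ R); last exact: closed_le.
move=> x _.
apply: (@continuous_cvg _ _ _ _ _ _ (fun M : 'M[R]_1 => M ord0 ord0)).
- exact: nbhs_filter.
- exact: (@coord_continuous R 1 1 ord0 ord0).
- exact: mulmx_continuous.
Qed.

(** The convex set whose support function is p when p is sublinear. *)
Definition wulff_shape n (p : 'rV[R]_n -> R) : set 'rV[R]_n :=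
  [set x | forall u, dot x u <= p u].

Lemma compact_wulff_shape n (p : 'rV[R]_n -> R) : compact (wulff_shape p).
Proof.
apply: bounded_closed_compact; last first.
  rewrite (_ : wulff_shape p = \bigcap_u [set x | dot x u <= p u]).
    by apply: closed_bigI => u _; exact: closed_halfspace.
  by apply/seteqP; split => x Hx u; [move=> _; exact: Hx|exact: Hx].
pose M := \sum_(i < n) (`|p (delta_mx ord0 i)| + `|p (- delta_mx ord0 i)|).
exists M; split; first exact: num_real.
move=> t Mt x Px; apply: le_trans (ltW Mt).
apply/row_norm_le; first by apply: sumr_ge0 => i _; rewrite addr_ge0.
move=> i; rewrite /M (bigD1 i)//=.
apply: (@le_trans _ _
  (`|p (delta_mx ord0 i)| + `|p (- delta_mx ord0 i)|)); last first.
  by rewrite lerDl sumr_ge0// => j _; rewrite addr_ge0.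
have := Px (delta_mx ord0 i); have := Px (- delta_mx ord0 i).
rewrite -scaleN1r dotZr dot_delta scaleN1r mulN1r => H1 H2.
rewrite ler_norml; apply/andP; split.
  have := ler_norm (p (- delta_mx ord0 i)).
  by have := normr_ge0 (p (delta_mx ord0 i)); lra.
have := ler_norm (p (delta_mx ord0 i)).
by have := normr_ge0 (p (- delta_mx ord0 i)); lra.
Qed.

(** The brightness is sublinear and bounded below by a positive constant on unit
    vectors, hence the support function of a convex body, by Hahn-Banach. *)
Lemma projection_body_exists m (K : set 'rV[R]_m.+1) : convex_body K ->
  exists P, is_projection_body K P.
Proof.
move=> bK; have [cK vK _] := bK.
have sK := brightness_sublinear bK.
exists (wulff_shape (brightness K)); split; first split.
- exact: compact_wulff_shape.
- apply/convexE => x y t Px Py /andP[t0 t1] u; rewrite dotDl !dotZl.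
  by have := Px u; have := Py u; nra.
- have [d d0 Hd] := brightness_lower_bound bK.
  exists 0; apply/nbhs_ballP; exists (d / m.+1%:R) => /=; first by rewrite divr_gt0.
  move=> x; rewrite -ball_normE /ball_/= sub0r normrN => xd u.
  have [->|u0] := eqVneq u 0.
    by rewrite brightness0// /dot big1// => i _; rewrite mxE mulr0.
  have [r [v [r0 vv ->]]] := polar_coordinates u0.
  rewrite dotZr (brightnessZ cK vK) ?(ltW r0)// ler_pM2l//.
  apply: le_trans (Hd v vv); apply: le_trans (dot_unit_le x vv) _.
  by rewrite -mulr_natr -ler_pdivlMr// ltW.
move=> u uu; rewrite -brightness_unit//; congr EFin.
rewrite /support_function.
have [x xu Hx] := hahn_banach_row u sK.
apply/eqP; rewrite eq_le; apply/andP; split.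
  by apply: sup_le_ub; [exists (dot x u); exists x|move=> _ [y Py <-]; exact: Py].
rewrite -xu; apply: ub_le_sup; last by exists x.
by exists (brightness K u) => _ [y Py <-]; exact: Py.
Qed.

(** By homogeneity the projection body's support function is the brightness in
    all directions, so that its polar is a sublevel set of the brightness. *)
Lemma polar_projection_body m (K : set 'rV[R]_m.+1) : convex_body K ->
  polar (projection_body K) = [set y | brightness K y <= 1].
Proof.
move=> bK; have [cK vK _] := bK.
have [[cP vP [x0 /interior_subset Px0]] hP] := getPex (projection_body_exists bK).
rewrite -/(projection_body K) in cP Px0 hP.
set P := projection_body K in cP Px0 hP *.
have supP u : unit_vector u -> has_sup [set dot x u | x in P].
  move=> uu; split; first by exists (dot x0 u); exists x0.
  have [r r0 Pr] := compact_sub_cube cP.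
  exists (r *+ m.+1) => _ [x /Pr xr <-].
  by apply: le_trans (dot_unit_le x uu) _; rewrite lerMn2r.
have hE u : unit_vector u -> support_function P u = brightness K u.
  by move=> uu; apply: EFin_inj; rewrite hP// brightness_unit.
apply/seteqP; split => y /=.
  move=> Py; have [->|y0] := eqVneq y 0; first by rewrite brightness0.
  have [r [u [r0 uu yE]]] := polar_coordinates y0.
  rewrite yE (brightnessZ cK vK) ?(ltW r0)// mulrC -ler_pdivlMr// mul1r -hE//.
  apply: sup_le_ub; first by exists (dot x0 u); exists x0.
  move=> _ [x Px <-]; have := Py x Px; rewrite yE dotZr.
  by rewrite -[r^-1]mul1r ler_pdivlMr// mulrC.
move=> hy x Px; have [y0|y0] := eqVneq y 0.
  by rewrite y0 /dot big1// => i _; rewrite mxE mulr0.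
have [r [u [r0 uu yE]]] := polar_coordinates y0.
move: hy; rewrite yE (brightnessZ cK vK) ?(ltW r0)// dotZr; apply: le_trans.
rewrite ler_pM2l// -hE//; apply: ub_le_sup; last by exists x.
by have [] := supP u uu.
Qed.

End projection_body.

(** * Touching translates *)

Section contact.
Variable R : realType.

Lemma interior_translate n (v : 'rV[R]_n) (K : set 'rV[R]_n) :
  interior (translate v K) = translate v (interior K).
Proof.
apply/seteqP; split => [z /interiorP[r r0 Kr]|_ [z /interiorP[r r0 Kr] <-]].
  exists (z - v); last by rewrite subrKC.
  apply/interiorP; exists r => // x /Kr[y Ky yE].
  by rewrite addrAC -yE addrAC subrr add0r.
apply/interiorP; exists r => // x /Kr Kzx; exists (z + x) => //; exact: addrA.
Qed.

Lemma interior_convex_comb n (K : set 'rV[R]_n) a c l : convex_set K ->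
  K a -> interior K c -> 0 <= l < 1 -> interior K (l *: a + (1 - l) *: c).
Proof.
move=> /convexE vK Ka /interiorP[r r0 Kr] /andP[l0 l1].
have l1' : 0 < 1 - l by rewrite subr_gt0.
apply/interiorP; exists ((1 - l) * r); first exact: mulr_gt0.
move=> x xr; rewrite (_ : _ + x = l *: a + (1 - l) *: (c + (1 - l)^-1 *: x)).
  apply: vK => //; last by rewrite l0 ltW.
  apply: Kr; rewrite normrZ gtr0_norm ?invr_gt0// mulrC ltr_pdivrMr//.
  by rewrite mulrC.
by rewrite scalerDr scalerA divff ?scale1r ?addrA// gt_eqF.
Qed.

(** The translation vectors x for which K and x + K touch. *)
Definition contact n (K : set 'rV[R]_n) (x : 'rV[R]_n) : Prop :=
  difference_body K x /\
  ~ exists a b, [/\ interior K a, interior K b & x = a - b].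

Lemma touchE n (K : set 'rV[R]_n) v w :
  touch (translate v K) (translate w K) <-> contact K (w - v).
Proof.
have sw (a b : 'rV[R]_n) : v + a = w + b <-> w - v = a - b.
  split => E; first by rewrite -(addrK b w) -E; apply/rowP => i; rewrite !mxE; ring.
  by rewrite -(subrKC v w) E; apply/rowP => i; rewrite !mxE; ring.
rewrite /touch !interior_translate; split => -[H1 H2]; split.
- case: H1 => _ [[a Ka <-] [b Kb ba]]; exists a => //; exists b => //.
  by apply/esym/sw.
- move=> [a [b [Ka Kb /sw ab]]].
  suff : (set0 : set 'rV[R]_n) (v + a) by [].
  by rewrite -H2; split; [exists a|exists b].
- case: H1 => a Ka [b Kb /esym/sw ab]; exists (v + a).
  by split; [exists a|exists b].
- apply/seteqP; split => // _ [[a Ka <-] [b Kb ba]]; apply: H2.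
  by exists a, b; split => //; apply/sw.
Qed.

Lemma difference_body_shrink n (K : set 'rV[R]_n) t x : convex_set K ->
  0 <= t <= 1 -> difference_body K x -> difference_body K (t *: x).
Proof.
move=> /convexE vK t01 [a Ka [b Kb <-]].
exists (t *: a + (1 - t) *: b); first exact: vK.
by exists b => //; apply/rowP => i; rewrite !mxE; ring.
Qed.

(** Moving both endpoints of a difference a - b towards a common interior point
    makes them interior and shrinks the difference; hence contact vectors are
    the last points of the difference body on their rays. *)
Lemma contact_expand n (K : set 'rV[R]_n) s x : convex_body K ->
  contact K x -> 1 < s -> ~ difference_body K (s *: x).
Proof.
move=> [cK vK [c ic]] [_ nx] s1 [a Ka [b Kb abE]]; apply: nx.
have s0 : 0 < s by rewrite (lt_trans ltr01).
have l01 : 0 <= s^-1 < 1 by rewrite invr_ge0 (ltW s0) invf_lt1.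
exists (s^-1 *: a + (1 - s^-1) *: c), (s^-1 *: b + (1 - s^-1) *: c).
split; [exact: interior_convex_comb|exact: interior_convex_comb|].
have -> : x = s^-1 *: (a - b) by rewrite abE scalerA mulVf ?scale1r// gt_eqF.
by apply/rowP => i; rewrite !mxE; ring.
Qed.

Lemma compact_difference_body n (K : set 'rV[R]_n) :
  compact K -> compact (difference_body K).
Proof.
move=> cK.
have -> : difference_body K =
    (fun p : 'rV[R]_n * 'rV[R]_n => p.1 - p.2) @` (K `*` K).
  apply/seteqP; split => [_ [a Ka [b Kb <-]]|_ [[a b] /= [Ka Kb] <-]].
    by exists (a, b).
  by exists a => //; exists b.
apply: continuous_compact; last exact: compact_setX.
apply: continuous_subspaceT => -[a b].
by apply: cvgB; [exact: cvg_fst|exact: cvg_snd].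
Qed.

(** The largest t with t y in the compact set K - K gives a contact vector: were
    it a difference of interior points, t could be increased. *)
Lemma contact_on_ray n (K : set 'rV[R]_n) y : convex_body K -> y != 0 ->
  exists2 t, 0 < t & contact K (t *: y).
Proof.
move=> [cK vK [c /interiorP[r r0 Kr]]] y0.
pose T := [set t : R | difference_body K (t *: y)].
have ny : 0 < `|y| by rewrite normr_gt0.
have Te : T (r / 2 / `|y|).
  exists (c + (r / 2 / `|y|) *: y).
    apply: Kr; rewrite normrZ gtr0_norm ?divr_gt0// divfK ?gt_eqF//.
    by rewrite ltr_pdivrMr// ltr_pMr// ltr1n.
  exists c; first by have := Kr 0; rewrite normr0 addr0; apply.
  by rewrite addrC addKr.
have cT : compact T.
  have cD := compact_difference_body cK.
  have [M M0 DM] := compact_sub_cube cD.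
  apply: (@subclosed_compact R^o _ `[- (M / `|y|), M / `|y|]%classic).
  - apply: (@closed_comp R^o 'rV[R]_n (fun t => t *: y)).
      by move=> t _; exact: scalel_continuous.
    by apply: compact_closed => //; exact: norm_hausdorff.
  - exact: segment_compact.
  - move=> t /DM; rewrite /cube/= normrZ -ler_pdivlMr//.
    by rewrite in_itv/= ler_norml.
have [t /set_mem Tt tmax] := compact_EVT_max (ex_intro _ _ Te) cT
   (@continuous_subspaceT _ _ T idfun (fun=> cvg_id)).
have e0 : 0 < r / 2 / `|y| by rewrite !divr_gt0.
exists t; first by apply: lt_le_trans e0 _; apply: tmax; exact: mem_set.
split => // -[a [b [/interiorP[s s0 Ks] ib abE]]].
have : T (t + s / 2 / `|y|).
  exists (a + (s / 2 / `|y|) *: y).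
    apply: Ks; rewrite normrZ gtr0_norm ?divr_gt0// divfK ?gt_eqF//.
    by rewrite ltr_pdivrMr// ltr_pMr// ltr1n.
  exists b; first exact: interior_subset.
  by rewrite scalerDl abE addrAC.
move=> /mem_set/tmax; rewrite gerDl leNgt => /negP; apply.
by rewrite !divr_gt0.
Qed.

Lemma brightness_gt0 m (K : set 'rV[R]_m.+1) x : convex_body K -> x != 0 ->
  0 < brightness K x.
Proof.
move=> bK x0; have [cK vK _] := bK; have [d d0 Hd] := brightness_lower_bound bK.
have [r [u [r0 uu ->]]] := polar_coordinates x0.
rewrite (brightnessZ cK vK) ?ltW// mulr_gt0// (lt_le_trans d0)//; exact: Hd.
Qed.

Lemma contact_neq0 n (K : set 'rV[R]_n) x : convex_body K -> contact K x -> x != 0.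
Proof.
move=> [_ _ [c ic]] [_ nx]; apply/eqP => x0; apply: nx.
by exists c, c; split => //; rewrite x0 subrr.
Qed.

Lemma constant_volume_brightness m (K : set 'rV[R]_m.+1) : convex_body K ->
  translative_constant_volume K <->
  forall x x', contact K x -> contact K x' -> brightness K x = brightness K x'.
Proof.
move=> [cK vK _].
have E v w : vol (conv_hull (translate v K `|` translate w K)) =
    (fine (vol K) + brightness K (w - v))%:E.
  rewrite conv_hull_translates// vol_translate ?vol_extrude_fin//.
  by apply: compact_row_measurable; exact: compact_extrude.
split=> [H x x' kx kx'|H v w v' w' /touchE k /touchE k'].
  have := H 0 x 0 x'; rewrite !touchE !subr0 !E !subr0 => /(_ kx kx') [].
  exact: addrI.
by rewrite !E (H _ _ k k').
Qed.

(** Write c for the constant brightness of contact vectors. On the ray of y, with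
    contact vector t y, homogeneity makes the brightness of y at most 1 exactly
    when c <= t, that is, when c y lies in the difference body. Conversely, if
    the sublevel set is lambda (K - K), a contact vector x of brightness less
    than 1 / lambda could be enlarged inside K - K. *)
Lemma constant_volume_polar_projection m (K : set 'rV[R]_m.+1) : convex_body K ->
  translative_constant_volume K <->
  exists lambda : R, 0 < lambda /\
    polar (projection_body K) = dilate lambda (difference_body K).
Proof.
move=> bK; have [cK vK _] := bK.
rewrite (constant_volume_brightness bK) (polar_projection_body bK).
split=> [H|[l [l0 lE]] x x' kx kx'].
  have e0 : (delta_mx ord0 ord0 : 'rV[R]_m.+1) != 0.
    apply/eqP => /rowP/(_ ord0); rewrite !mxE !eqxx => /eqP.
    exact/negP/oner_neq0.
  have [t0 t00 k0] := contact_on_ray bK e0.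
  set x0 := t0 *: _ in k0; set c := brightness K x0.
  have c0 : 0 < c by apply: brightness_gt0 => //; exact: contact_neq0 k0.
  exists c^-1; split; first by rewrite invr_gt0.
  apply/seteqP; split => [y /= hy|_ [x Dx <-]] /=.
    exists (c *: y); last by rewrite scalerA mulVf ?scale1r// gt_eqF.
    have [->|y0] := eqVneq y 0.
      rewrite scaler0 -(scale0r x0); apply: difference_body_shrink => //.
        by rewrite lexx ler01.
      by case: k0.
    have [t tp kt] := contact_on_ray bK y0.
    have := H _ _ kt k0; rewrite (brightnessZ cK vK) ?(ltW tp)// -/c => ht.
    have -> : c *: y = (c / t) *: (t *: y) by rewrite scalerA divfK// gt_eqF.
    apply: difference_body_shrink => //; last by case: kt.
    rewrite divr_ge0 ?(ltW c0) ?(ltW tp)//= ler_pdivrMr// mul1r -ht.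
    by rewrite ler_piMr// ltW.
  have [->|x0'] := eqVneq x 0; first by rewrite scaler0 brightness0.
  have [t tp kt] := contact_on_ray bK x0'.
  have := H _ _ kt k0; rewrite (brightnessZ cK vK) ?(ltW tp)// -/c => ht.
  rewrite (brightnessZ cK vK) ?invr_ge0 ?(ltW c0)// mulrC ler_pdivrMr// mul1r -ht.
  rewrite ler_peMl ?(ltW (brightness_gt0 bK x0'))// leNgt; apply/negP => t1.
  apply: (contact_expand bK kt (s := t^-1)); first by rewrite invf_gt1.
  by rewrite scalerA mulVf ?scale1r// gt_eqF.
suff V z : contact K z -> brightness K z = l^-1 by rewrite !V.
move=> kz; have hz := brightness_gt0 bK (contact_neq0 bK kz).
have : [set y | brightness K y <= 1] (l *: z).
  by rewrite lE; exists z => //; case: kz.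
rewrite /= (brightnessZ cK vK) ?(ltW l0)// le_eqVlt => /predU1P[lz|lz].
  by rewrite -[RHS]mulr1 -lz mulKf// gt_eqF.
have lz0 : 0 < l * brightness K z by rewrite mulr_gt0.
pose s := (l * brightness K z)^-1.
have [] := contact_expand bK kz (s := s); first by rewrite invf_gt1.
have : [set y | brightness K y <= 1] (l *: (s *: z)).
  rewrite /= scalerA mulrC -scalerA.
  rewrite !(brightnessZ cK vK) ?(ltW l0)// ?invr_ge0 ?(ltW lz0)//.
  by rewrite mulVf// gt_eqF.
rewrite lE => -[w Dw] /(congr1 ( *:%R l^-1)).
rewrite !scalerA mulVf ?gt_eqF// !mul1r scale1r.
by move=> <-.
Qed.

End contact.

Unset Implicit Arguments.
Set Strict Implicit.

Theorem theorem3 (R : realType) (n : nat) (hn : (3 <= n)%N)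
    (K : set 'rV[R]_n) (hK : convex_body K) :
  translative_constant_volume K <->
  exists lambda : R, 0 < lambda /\
    polar (projection_body K) = dilate lambda (difference_body K).
Proof.
by case: n hn K hK => // m _ K hK; exact: constant_volume_polar_projection.
Qed.
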